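(* Let $\Omega\subset\hat G$ be a measurable set with finite and non-zero Haar measure, let $\Lambda\subset G$ and $A\subset\mathrm{Aut}(G)$ be countable, and assume that $\Omega$ is a Riesz wavelet set with respect to the translations by $\Lambda$ and the dilations by $A$. Then $\Omega$ is a multiplicative tiling for $\hat G$ with respect to the automorphisms $A$ (i.e. $\sum_{\alpha\in A}1_{\hat\alpha(\Omega)}(\xi)=1$ for a.e. $\xi\in\hat G$) if and only if $(\hat\alpha(\Omega),\alpha^{-1}(-\Lambda))$ is a Riesz spectral pair for all $\alpha\in A$.
   Context: $(G,+)$ is an infinite, non-discrete, second countable locally compact abelian (LCA) group with identity $e$, which admits a lattice (a discrete co-compact subgroup); $\hat G$ is its dual group. $m_G$ and $m_{\hat G}$ are Haar measures on $G$ and $\hat G$, normalized so that the Fourier transform $\hat f(\xi)=\int_G f(x)\overline{\langle \xi,x\rangle}\,dm_G(x)$ extends to a unitary map $L^2(G)\to L^2(\hat G)$. $\mathrm{Aut}(G)$ is the group of topological automorphisms of $G$. The modular function $\Delta:\mathrm{Aut}(G)\to(0,\infty)$ is defined by $m_G(\alpha(E))=\Delta(\alpha)m_G(E)$ for measurable $E\subset G$; it is assumed that $\Delta$ is not identically $1$. For $\alpha\in\mathrm{Aut}(G)$ the adjoint automorphism $\hat\alpha\in \mathrm{Aut}(\hat G)$ is defined by $\langle\hat\alpha(\xi),x\rangle=\langle\xi,\alpha(x)\rangle$. $-\Lambda=\{-\lambda:\lambda\in\Lambda\}$. For $t\in G$ write $\chi_t(\xi)=\langle\xi,t\rangle$,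 $\xi\in\hat G$. For measurable $E\subset\hat G$ of non-zero measure and countable $T\subset G$, $(E,T)$ is a Riesz spectral pair if the family $\{\chi_t:t\in T\}$ (restricted to $E$) is a Riesz basis for $L^2(E)$. $\Omega$ is a Riesz wavelet set with respect to the translations by $\Lambda$ and the dilations by $A$ if the family $\{\psi_{\lambda,\alpha}:\lambda\in\Lambda,\ \alpha\in A\}$, indexed by the pairs $(\lambda,\alpha)$, is a Riesz basis for $L^2(G)$, where $\psi_{\lambda,\alpha}(x)=\Delta(\alpha)^{1/2}\psi(\alpha(x)-\lambda)$ and $\psi\in L^2(G)$ is given by $\hat\psi=1_\Omega$. *)

(* Defs.v *)
From HB Require Import structures.
From mathcomp Require Import all_boot all_order all_algebra.
From mathcomp Require Import finmap.
From mathcomp Require Import generic_quotient.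
From mathcomp Require Import all_classical all_reals all_analysis.
From mathcomp Require Import complex.

Set Implicit Arguments.
Unset Strict Implicit.
Unset Printing Implicit Defensive.

Import Order.TTheory GRing.Theory Num.Theory.
Import numFieldNormedType.Exports.

Local Open Scope classical_set_scope.
Local Open Scope ring_scope.
Local Open Scope complex_scope.

(* [g_sigma_algebraType] asks for a pointed carrier; the point is 0. *)
Definition pointed_at_zero (T : zmodType) : Type := T.
HB.instance Definition _ (T : zmodType) := Choice.on (pointed_at_zero T).
HB.instance Definition _ (T : zmodType) :=
  isPointed.Build (pointed_at_zero T) (0 : T).

Definition borel (T : PreTopologicalZmodule.type) : Type :=
  g_sigma_algebraType (@open T : set (set (pointed_at_zero T))).
HB.instance Definition _ (T : PreTopologicalZmodule.type) :=
  Measurable.on (borel T).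

(* Nonzero translation-invariant Radon measure on the Borel sets. *)
Definition is_haar (R : realType) (T : PreTopologicalZmodule.type)
    (mu : {measure set (borel T) -> \bar R}) : Prop :=
  [/\ mu [set: T] != 0%E,
      forall (x : T) (E : set (borel T)), measurable E ->
        mu [set x + y | y in (E : set T)] = mu E,
      forall K : set T, compact K -> (mu K < +oo)%E,
      forall E : set (borel T), measurable E ->
        mu E = ereal_inf [set mu U | U in [set U : set T | open U /\ E `<=` U]]
    & forall U : set T, open U ->
        mu U = ereal_sup [set mu K | K in [set K : set T | compact K /\ K `<=` U]]].

Definition is_discrete (T : topologicalType) : Prop := forall U : set T, open U.

Record subgroup (G : zmodType) := Subgroup {
  subgroup_set :> G -> Prop;
  subgroup0 : subgroup_set 0;
  subgroupB : forall x y,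
    subgroup_set x -> subgroup_set y -> subgroup_set (x - y) }.

Section Quotient.
Local Open Scope quotient_scope.
Variables (G : topologicalZmodType) (H : subgroup G).

Definition coset_rel : rel G := fun x y => `[< H (x - y) >].

Lemma coset_rel_equiv : equiv_class_of coset_rel.
Proof.
have HN x y : H (x - y) -> H (y - x).
  by move=> Hxy; rewrite -opprB -[X in H X]add0r; apply: subgroupB => //;
    exact: subgroup0.
split => [x|x y|y x z].
- by apply/asboolP; rewrite subrr; exact: subgroup0.
- by apply/asboolP/asboolP; exact: HN.
- move=> /asboolP xy /asboolP yz; apply/asboolP.
  by rewrite -(subrKA y) -[y - z]opprB; apply: subgroupB => //; exact: HN.
Qed.

Definition coset_equiv : equiv_rel G := EquivRelPack coset_rel_equiv.

Definition is_lattice : Prop :=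
  is_discrete (set_type (H : set G)) /\
  compact [set: quotient_topology {eq_quot coset_equiv}].
End Quotient.

Record dual (R : realType) (G : topologicalZmodType) := Character {
  char_fun :> G -> R[i];
  charD : forall x y, char_fun (x + y) = char_fun x * char_fun y;
  char_norm : forall x, `|char_fun x| = 1;
  char_continuous : continuous (char_fun : G -> R[i]^o) }.

Section Dual.
Variables (R : realType) (G : topologicalZmodType).
Implicit Types xi eta : dual R G.

Lemma dual_ext xi eta : (forall x, xi x = eta x) -> xi = eta.
Proof.
case: xi eta => [f fD f1 fc] [g gD g1 gc] /= fg.
have {fg} fg : f = g by exact/funext.
by rewrite -{}fg in gD g1 gc *; congr Character; exact: Prop_irrelevance.
Qed.

HB.instance Definition _ := gen_eqMixin (dual R G).
HB.instance Definition _ := gen_choiceMixin (dual R G).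

Lemma char_neq0 xi x : xi x != 0.
Proof. by rewrite -normr_eq0 char_norm oner_eq0. Qed.

(* The dual group is written additively: xi + eta is the pointwise product. *)
Definition dual_zero : dual R G.
Proof.
refine (@Character R G (fun=> 1) _ _ _).
- by move=> x y; rewrite mulr1.
- by move=> x; rewrite normr1.
- exact: cst_continuous.
Defined.

Definition dual_add xi eta : dual R G.
Proof.
refine (@Character R G (fun x => xi x * eta x) _ _ _).
- by move=> x y; rewrite !charD mulrACA.
- by move=> x; rewrite normrM !char_norm mulr1.
- by move=> x; apply: cvgM; exact: char_continuous.
Defined.

Definition dual_opp xi : dual R G.
Proof.
refine (@Character R G (fun x => (xi x)^-1) _ _ _).
- by move=> x y; rewrite charD invfM.
- by move=> x; rewrite normfV char_norm invr1.
- by move=> x; apply: cvgV; [exact: char_neq0 | exact: char_continuous].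
Defined.

Lemma dual_addA : associative dual_add.
Proof. by move=> xi eta zeta; apply: dual_ext => x /=; rewrite mulrA. Qed.
Lemma dual_addC : commutative dual_add.
Proof. by move=> xi eta; apply: dual_ext => x /=; rewrite mulrC. Qed.
Lemma dual_add0 : left_id dual_zero dual_add.
Proof. by move=> xi; apply: dual_ext => x /=; rewrite mul1r. Qed.
Lemma dual_addN : left_inverse dual_zero dual_opp dual_add.
Proof.
by move=> xi; apply: dual_ext => x /=; rewrite mulVf// char_neq0.
Qed.

HB.instance Definition _ :=
  GRing.isZmodule.Build (dual R G) dual_addA dual_addC dual_add0 dual_addN.

Definition dual_to_fun xi : {compact-open, G -> R[i]^o} := xi.

HB.instance Definition _ :=
  Topological.copy (dual R G) (initial_topology dual_to_fun).
End Dual.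

Record aut (G : topologicalZmodType) := Aut {
  aut_fun :> G -> G;
  aut_inv : G -> G;
  autD : forall x y, aut_fun (x + y) = aut_fun x + aut_fun y;
  autK : cancel aut_fun aut_inv;
  autVK : cancel aut_inv aut_fun;
  aut_continuous : continuous aut_fun;
  autV_continuous : continuous aut_inv }.

Section Aut.
Variable G : topologicalZmodType.
Implicit Types alpha beta : aut G.

(* Hence an automorphism occurs only once in an index set [A : set (aut G)]. *)
Lemma aut_ext alpha beta : (forall x, alpha x = beta x) -> alpha = beta.
Proof.
case: alpha beta => [f f' fD fK f'K fc f'c] [g g' gD gK g'K gc g'c] /= fg.
have {}fg : f = g by exact/funext.
have fg' : f' = g' by apply/funext => x; rewrite -{2}(f'K x) fg gK.
rewrite -{}fg -{}fg' in gD gK g'K gc g'c *.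
by congr Aut; exact: Prop_irrelevance.
Qed.

HB.instance Definition _ := gen_eqMixin (aut G).
HB.instance Definition _ := gen_choiceMixin (aut G).

Definition adjoint (R : realType) alpha (xi : dual R G) : dual R G.
Proof.
refine (@Character R G (fun x => xi (alpha x)) _ _ _).
- by move=> x y; rewrite autD charD.
- by move=> x; exact: char_norm.
- by move=> x; apply: continuous_comp;
    [exact: aut_continuous | exact: char_continuous].
Defined.

Definition is_modular (R : realType) (mu : {measure set (borel G) -> \bar R})
    (Delta : aut G -> R) : Prop :=
  forall alpha, 0 < Delta alpha /\
    forall E : set (borel G), measurable E ->
      mu [set alpha x | x in (E : set G)] = ((Delta alpha)%:E * mu E)%E.
End Aut.

Section L2.
Context d (T : measurableType d) (R : realType).
Variable mu : {measure set T -> \bar R}.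
Implicit Types (E : set T) (f g : T -> R[i]).

Definition cmeasurable E f : Prop :=
  measurable_fun E (fun x => complex.Re (f x)) /\
  measurable_fun E (fun x => complex.Im (f x)).

Definition in_L1 E f : Prop :=
  mu.-integrable E (fun x => (complex.Re (f x))%:E) /\
  mu.-integrable E (fun x => (complex.Im (f x))%:E).

Definition cintegral E f : R[i] :=
  (\int[mu]_(x in E) complex.Re (f x)) +i* (\int[mu]_(x in E) complex.Im (f x)).

Definition L2_sqnorm E f : \bar R :=
  (\int[mu]_(x in E) ((Normc.normc (f x) ^+ 2)%R)%:E)%E.

Definition in_L2 E f : Prop := cmeasurable E f /\ (L2_sqnorm E f < +oo)%E.

Definition lincomb (I : choiceType) (f : I -> T -> R[i]) (F : {fset I})
  (c : I -> R[i]) : T -> R[i] := fun x => \sum_(i <- F) c i * f i x.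

(* The subfamily of f indexed by D is a Riesz basis for L^2(E): it is complete
   and satisfies the two-sided Riesz inequality. *)
Definition riesz_basis E (I : choiceType) (D : set I) (f : I -> T -> R[i]) : Prop :=
  [/\ forall i, D i -> in_L2 E (f i),
      forall g, in_L2 E g -> forall e : R, 0 < e ->
        exists (F : {fset I}) (c : I -> R[i]), [set` F] `<=` D /\
          (L2_sqnorm E (g \- lincomb f F c)%R < e%:E)%E
    & exists a b : R, [/\ 0 < a, 0 < b &
        forall (F : {fset I}) (c : I -> R[i]), [set` F] `<=` D ->
          ((a * \sum_(i <- F) Normc.normc (c i) ^+ 2)%:E
             <= L2_sqnorm E (lincomb f F c)
             <= (b * \sum_(i <- F) Normc.normc (c i) ^+ 2)%:E)%E]].
End L2.

Section Fourier.
Variables (R : realType) (G : topologicalZmodType).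
Variable mG : {measure set (borel G) -> \bar R}.
Variable mGhat : {measure set (borel (dual R G)) -> \bar R}.

Definition fourier (f : G -> R[i]) (xi : dual R G) : R[i] :=
  cintegral mG [set: borel G] (fun x => f x * (xi x)^*%C).

(* g represents the L^2 extension of the Fourier transform at f. *)
Definition L2_fourier (f : G -> R[i]) (g : dual R G -> R[i]) : Prop :=
  [/\ in_L2 mG [set: borel G] f, in_L2 mGhat [set: borel (dual R G)] g &
      exists u : nat -> G -> R[i],
      [/\ forall n, in_L1 mG [set: borel G] (u n) /\ in_L2 mG [set: borel G] (u n),
          L2_sqnorm mG [set: borel G] (u n \- f)%R
            @[n --> \oo] --> (0 : \bar R)
        & L2_sqnorm mGhat [set: borel (dual R G)]
            (fourier (u n) \- g)%R @[n --> \oo] --> (0 : \bar R)]].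

(* The Fourier transform is isometric on L^1 /\ L^2, and its extension to L^2
   is onto. *)
Definition fourier_unitary : Prop :=
  (forall f, in_L1 mG [set: borel G] f -> in_L2 mG [set: borel G] f ->
     in_L2 mGhat [set: borel (dual R G)] (fourier f) /\
     L2_sqnorm mGhat [set: borel (dual R G)] (fourier f) =
     L2_sqnorm mG [set: borel G] f) /\
  (forall g, in_L2 mGhat [set: borel (dual R G)] g -> exists f, L2_fourier f g).

Definition riesz_spectral_pair (E : set (borel (dual R G))) (T : set G) : Prop :=
  [/\ measurable E, mGhat E != 0%E, countable T &
      riesz_basis mGhat E T (fun (t : G) (xi : dual R G) => xi t)].

Variable Delta : aut G -> R.

Definition wavelet (psi : G -> R[i]) (i : G * aut G) (x : G) : R[i] :=
  (Num.sqrt (Delta i.2))%:C * psi (i.2 x - i.1).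

Definition riesz_wavelet_set (Omega : set (dual R G)) (Lambda : set G)
    (A : set (aut G)) : Prop :=
  exists psi : G -> R[i],
    L2_fourier psi (fun xi => (\1_Omega xi)%:C) /\
    riesz_basis mG [set: borel G] (Lambda `*` A) (wavelet psi).

Definition multiplicative_tiling (Omega : set (dual R G)) (A : set (aut G)) : Prop :=
  {ae mGhat, forall xi : dual R G,
    (\esum_(alpha in A) (\1_([set adjoint alpha eta | eta in Omega]) xi : R)%:E
       = 1)%E}.
End Fourier.

(* Main.v *)
From HB Require Import structures.
Require Import Defs.
From mathcomp Require Import all_boot all_order all_algebra.
From mathcomp Require Import finmap.
From mathcomp Require Import all_classical all_reals all_analysis.
From mathcomp Require Import measurable_realfun complex ring lra.

Set Implicit Arguments.
Unset Strict Implicit.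
Unset Printing Implicit Defensive.

Import Order.TTheory GRing.Theory Num.Theory.
Import numFieldNormedType.Exports.
Local Open Scope classical_set_scope.
Local Open Scope ring_scope.
Local Open Scope complex_scope.

(** The Fourier transform carries the wavelet
    [x |-> Delta alpha ^ (1/2) * psi (alpha x - lambda)] to
    [Delta alpha ^ (-1/2) * chi_t * 1_E] with [t = - alpha^-1 lambda] and
    [E = adjoint alpha @` Omega] ([L2_fourier_wavelet]).  As it is unitary, the
    wavelets form a Riesz basis of L^2(G) only if these functions form one of
    L^2 of the dual group ([riesz_basis_fourier]).  The theorem is thereby
    reduced to a Riesz basis of L^2(T) each member of which is supported by one
    of countably many pieces E_j of a sigma-finite measure space T.

    When the pieces are almost disjoint, restricting functions to E_j kills
    every member of the basis that belongs to another piece, and the members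
    that belong to E_j form a Riesz basis of L^2(E_j) ([riesz_basis_piece]).

    Conversely, let the members belonging to E_j form a Riesz basis of L^2(E_j)
    for every j.  The indicator function of the intersection of E_j and E_k is
    close to a combination p of the functions on E_j and close to a combination
    q of the functions on E_k.  Then p - q is small, and the lower Riesz bound
    for the whole family, in which p and q involve different members, makes the
    coefficients of p small.  By the upper bound p itself is small, so the
    intersection is null ([riesz_pieces_disjoint]).  A function that vanishes on
    all the pieces is orthogonal to the whole family, so by completeness the
    pieces cover almost everything ([riesz_pieces_cover]).

    The formula for the transform of a wavelet is meaningful only if the adjoint
    automorphisms preserve the null sets of the dual group.  They even multiply
    Haar measure by a constant ([adjoint_scaling]), by uniqueness of Haar
    measure, which is Tonelli's theorem applied to the set of the pairs (x, y)
    with x in E and x - y in F ([translation_invariant_proportional]).  Tonelli's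
    theorem asks that subtraction be measurable for the product of the Borel
    sigma-algebras and that Haar measure be sigma-finite.  Both follow from the
    second countability of the dual group, which is inherited from G
    ([dual_second_countable]). *)

(** * Countable unions *)

(** Countable additivity is a statement about sequences, while the unions below
    are indexed by automorphisms, pairs of automorphisms or open sets.  An
    injection of the index set into the integers turns one into the other, the
    integers outside its image receiving the empty set. *)
Lemma countable_bigcup_sequence (T : Type) (I : choiceType) (D : set I)
    (F : I -> set T) : countable D ->
  exists2 u : nat -> set T, \bigcup_(i in D) F i = \bigcup_n u n &
    forall n, u n = set0 \/ exists2 i, D i & u n = F i.
Proof.
move=> /countable_injP[f finj].
exists (fun n => \bigcup_(i in D `&` f @^-1` [set n]) F i).
  apply/seteqP; split=> [x [i Di Fix]|x [n _ [i [Di _] Fix]]]; last by exists i.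
  by exists (f i) => //; exists i.
move=> n; have [[i [Di <-]]|nD] := pselect (exists i, D i /\ f i = n).
  right; exists i => //; rewrite (_ : D `&` _ = [set i]) ?bigcup_set1//.
  apply/seteqP; split=> [j [Dj /= fji]|j ->//].
  by apply: finj => //; exact/mem_set.
left; rewrite (_ : D `&` _ = set0) ?bigcup_set0//.
by rewrite -subset0 => i [Di fin]; apply: nD; exists i.
Qed.

Lemma measurable_bigcup_countable d (T : sigmaRingType d) (I : choiceType)
    (D : set I) (F : I -> set T) :
  countable D -> (forall i, D i -> measurable (F i)) ->
  measurable (\bigcup_(i in D) F i).
Proof.
move=> cD mF; have [u -> uF] := countable_bigcup_sequence F cD.
apply: bigcupT_measurable => n.
by have [->|[i Di ->]] := uF n; [exact: measurable0|exact: mF].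
Qed.

Lemma negligible_bigcup_countable d (T : measurableType d) (R : realType)
    (mu : {measure set T -> \bar R}) (I : choiceType) (D : set I) (F : I -> set T) :
  countable D -> (forall i, D i -> mu.-negligible (F i)) ->
  mu.-negligible (\bigcup_(i in D) F i).
Proof.
move=> cD mF; have [u -> uF] := countable_bigcup_sequence F cD.
apply: negligible_bigcup => n.
by have [->|[i Di ->]] := uF n; [exact: negligible_set0|exact: mF].
Qed.

(** * Square norms of complex functions *)

Section Modulus.
Variable R : realType.
Implicit Types z w : R[i].

Definition normc2 z : R := Normc.normc z ^+ 2.

Lemma normc2E z : normc2 z = complex.Re z ^+ 2 + complex.Im z ^+ 2.
Proof.
by rewrite /normc2; case: z => a b /=; rewrite sqr_sqrtr// addr_ge0// sqr_ge0.
Qed.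

Lemma normc2_ge0 z : 0 <= normc2 z.
Proof. exact: sqr_ge0. Qed.

Lemma normc2M z w : normc2 (z * w) = normc2 z * normc2 w.
Proof. by rewrite /normc2 Normc.normcM exprMn. Qed.

Lemma normc2_real (r : R) : normc2 r%:C = r ^+ 2.
Proof. by rewrite normc2E /= expr0n addr0. Qed.

Lemma normc2N z : normc2 (- z) = normc2 z.
Proof. by rewrite !normc2E; case: z => a b /=; rewrite !sqrrN. Qed.

Lemma normc20 : normc2 0 = 0.
Proof. by rewrite normc2E /= expr0n addr0. Qed.

Lemma normc2_unit z : `|z| = 1 -> normc2 z = 1.
Proof.
move=> z1; have := sqr_normc z.
rewrite z1 expr1n normc2E; case: z {z1} => a b /= [E _].
by rewrite !expr2; lra.
Qed.

(** The difference of the two sides is [e^-1 * normc2 (e * z - w)].  With [e] small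
    this loses only a factor close to 1 on [z]; integrated, it does the work of
    the triangle inequality directly on squares of norms. *)
Lemma normc2D (e : R) z w : 0 < e ->
  normc2 (z + w) <= (1 + e) * normc2 z + (1 + e^-1) * normc2 w.
Proof.
move=> e0; rewrite !normc2E.
case: z w => [a b] [c d] /=.
have h (x y : R) : (x + y) ^+ 2 <= (1 + e) * x ^+ 2 + (1 + e^-1) * y ^+ 2.
  rewrite -subr_ge0.
  have -> : (1 + e) * x ^+ 2 + (1 + e^-1) * y ^+ 2 - (x + y) ^+ 2 =
      e^-1 * (e * x - y) ^+ 2.
    by field; exact: lt0r_neq0.
  by rewrite mulr_ge0 ?sqr_ge0// invr_ge0 ltW.
have := h a c; have := h b d; lra.
Qed.

End Modulus.

Section L2calculus.
Context d (T : measurableType d) (R : realType).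
Variable mu : {measure set T -> \bar R}.
Implicit Types (E : set T) (f g : T -> R[i]).

Lemma cmeasurable_cst E (k : R[i]) : cmeasurable E (fun=> k).
Proof. by split; exact: measurable_cst. Qed.

Lemma cmeasurableD E f g : cmeasurable E f -> cmeasurable E g ->
  cmeasurable E (fun x => f x + g x).
Proof.
move=> [f1 f2] [g1 g2]; split.
  rewrite [X in measurable_fun _ X](_ : _ =
    (fun x => complex.Re (f x) + complex.Re (g x))); first exact: measurable_funD.
  by apply/funext => x; case: (f x) (g x) => ? ? [].
rewrite [X in measurable_fun _ X](_ : _ =
    (fun x => complex.Im (f x) + complex.Im (g x))); first exact: measurable_funD.
by apply/funext => x; case: (f x) (g x) => ? ? [].
Qed.

Lemma cmeasurableM E f g : cmeasurable E f -> cmeasurable E g ->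
  cmeasurable E (fun x => f x * g x).
Proof.
move=> [f1 f2] [g1 g2]; split.
  rewrite [X in measurable_fun _ X](_ : _ = (fun x =>
    complex.Re (f x) * complex.Re (g x) - complex.Im (f x) * complex.Im (g x))).
    by apply: measurable_funB; exact: measurable_funM.
  by apply/funext => x; case: (f x) (g x) => ? ? [].
rewrite [X in measurable_fun _ X](_ : _ = (fun x =>
    complex.Re (f x) * complex.Im (g x) + complex.Im (f x) * complex.Re (g x))).
  by apply: measurable_funD; exact: measurable_funM.
by apply/funext => x; case: (f x) (g x) => ? ? [].
Qed.

Lemma cmeasurable_sum E (I : Type) (s : seq I) (f : I -> T -> R[i]) :
  (forall i, cmeasurable E (f i)) -> cmeasurable E (fun x => \sum_(i <- s) f i x).
Proof.
move=> mf; elim: s => [|i s ih].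
  by under eq_fun do rewrite big_nil; exact: cmeasurable_cst.
by under eq_fun do rewrite big_cons; exact: cmeasurableD.
Qed.

Lemma cmeasurable_indic E (S : set T) : measurable S ->
  cmeasurable E (fun x => (\1_S x)%:C : R[i]).
Proof.
by move=> mS; split => /=; [exact: measurable_indic|exact: measurable_cst].
Qed.

Lemma measurable_normc2 E f : cmeasurable E f ->
  measurable_fun E (fun x => (normc2 (f x))%:E).
Proof.
move=> [f1 f2]; apply/measurable_EFinP.
rewrite [X in measurable_fun _ X](_ : _ =
  (fun x => complex.Re (f x) ^+ 2 + complex.Im (f x) ^+ 2)).
  by apply: measurable_funD; exact: measurable_funX.
by apply/funext => x; rewrite normc2E.
Qed.

Lemma L2_sqnorm_ge0 E f : (0 <= L2_sqnorm mu E f)%E.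
Proof. by apply: integral_ge0 => x _; rewrite lee_fin sqr_ge0. Qed.

Lemma L2_sqnorm_eq E f g : (forall x, E x -> f x = g x) ->
  L2_sqnorm mu E f = L2_sqnorm mu E g.
Proof. by move=> fg; apply: eq_integral => x /set_mem/fg ->. Qed.

Lemma L2_sqnorm_le E f g : measurable E -> cmeasurable E f -> cmeasurable E g ->
  (forall x, E x -> normc2 (f x) <= normc2 (g x)) ->
  (L2_sqnorm mu E f <= L2_sqnorm mu E g)%E.
Proof.
move=> mE mf mg fg; apply: ge0_le_integral => //.
- by move=> x _; rewrite lee_fin sqr_ge0.
- exact: measurable_normc2.
- exact: measurable_normc2.
Qed.

Lemma L2_sqnormZ E (k : R[i]) f : measurable E -> cmeasurable E f ->
  L2_sqnorm mu E (fun x => k * f x)%R = ((normc2 k)%:E * L2_sqnorm mu E f)%E.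
Proof.
move=> mE mf; rewrite /L2_sqnorm -ge0_integralZl//; last 3 first.
- exact: measurable_normc2.
- by move=> x _; rewrite lee_fin sqr_ge0.
- by rewrite lee_fin sqr_ge0.
by apply: eq_integral => x _; rewrite -EFinM -exprMn -Normc.normcM.
Qed.

Lemma L2_sqnorm0 E : L2_sqnorm mu E (fun=> 0) = 0%E.
Proof. by rewrite /L2_sqnorm; apply: integral0_eq => x _; rewrite -/(normc2 _) normc20. Qed.

Lemma L2_sqnormD E (e : R) f g : measurable E -> 0 < e ->
  cmeasurable E f -> cmeasurable E g ->
  (L2_sqnorm mu E (fun x => f x + g x)%R <=
   (1 + e)%:E * L2_sqnorm mu E f + (1 + e^-1)%:E * L2_sqnorm mu E g)%E.
Proof.
move=> mE e0 mf mg.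
have e1 : 0 <= 1 + e by lra.
have e2 : 0 <= 1 + e^-1 by rewrite addr_ge0// invr_ge0 ltW.
have mf2 := measurable_normc2 mf; have mg2 := measurable_normc2 mg.
rewrite /L2_sqnorm -!ge0_integralZl//; try by move=> x _; rewrite lee_fin sqr_ge0.
rewrite -ge0_integralD//; first last.
- exact: measurable_funeM.
- by move=> x _; rewrite mule_ge0 ?lee_fin ?sqr_ge0.
- exact: measurable_funeM.
- by move=> x _; rewrite mule_ge0 ?lee_fin ?sqr_ge0.
apply: ge0_le_integral => //.
- by move=> x _; rewrite lee_fin sqr_ge0.
- exact/measurable_normc2/cmeasurableD.
- by apply: emeasurable_funD; exact: measurable_funeM.
- by move=> x _; rewrite -!EFinM -EFinD lee_fin; exact: normc2D.
Qed.

Lemma L2_sqnormD2 E f g : measurable E -> cmeasurable E f -> cmeasurable E g ->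
  (L2_sqnorm mu E (fun x => f x + g x)%R <=
   2%:E * (L2_sqnorm mu E f + L2_sqnorm mu E g))%E.
Proof.
move=> mE mf mg; rewrite ge0_muleDr ?L2_sqnorm_ge0//.
have := L2_sqnormD mE ltr01 mf mg.
by rewrite invr1 -[1 + 1]/(2%:R).
Qed.

Lemma in_L2D E f g : measurable E -> in_L2 mu E f -> in_L2 mu E g ->
  in_L2 mu E (fun x => f x + g x).
Proof.
move=> mE [mf f2] [mg g2]; split; first exact: cmeasurableD.
apply: (le_lt_trans (L2_sqnormD2 mE mf mg)).
by rewrite lte_mul_pinfty// lte_add_pinfty.
Qed.

Lemma in_L2Z E (k : R[i]) f : measurable E -> in_L2 mu E f ->
  in_L2 mu E (fun x => k * f x).
Proof.
move=> mE [mf f2]; split; first by apply: cmeasurableM => //; exact: cmeasurable_cst.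
by rewrite L2_sqnormZ// lte_mul_pinfty// lee_fin sqr_ge0.
Qed.

Lemma in_L20 E : in_L2 mu E (fun=> 0).
Proof. by split; [exact: cmeasurable_cst|rewrite L2_sqnorm0]. Qed.

Lemma in_L2B E f g : measurable E -> in_L2 mu E f -> in_L2 mu E g ->
  in_L2 mu E (fun x => f x - g x).
Proof.
move=> mE f2 g2; under eq_fun do rewrite -mulN1r.
by apply: in_L2D => //; exact: in_L2Z.
Qed.

Lemma cmeasurableB E f g : cmeasurable E f -> cmeasurable E g ->
  cmeasurable E (fun x => f x - g x).
Proof.
move=> f2 g2; under eq_fun do rewrite -mulN1r.
by apply: cmeasurableD => //; apply: cmeasurableM => //; exact: cmeasurable_cst.
Qed.

Lemma L2_sqnorm_sub E f g : L2_sqnorm mu E (fun x => f x - g x) =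
  L2_sqnorm mu E (fun x => g x - f x).
Proof.
by apply: eq_integral => x _; rewrite -/(normc2 _) -opprB normc2N.
Qed.

End L2calculus.

Section Limits.
Context d (T : measurableType d) (R : realType).
Variable mu : {measure set T -> \bar R}.

Lemma cvge0_lt (u : nat -> \bar R) (e : R) : 0 < e ->
  u n @[n --> \oo] --> (0 : \bar R) -> \forall n \near \oo, (u n < e%:E)%E.
Proof.
move=> e0 /(_ [set y | y < e%:E]%E); apply; apply: open_nbhs_nbhs.
by split; [exact: open_ereal_lt_ereal|rewrite /= lte_fin].
Qed.

Lemma in_L2_fin E f : in_L2 mu E f -> exists2 r : R, 0 <= r & L2_sqnorm mu E f = r%:E.
Proof.
move=> [_ f2]; exists (fine (L2_sqnorm mu E f)); first by rewrite fine_ge0// L2_sqnorm_ge0.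
by rewrite fineK// ge0_fin_numE// L2_sqnorm_ge0.
Qed.

Lemma cvge0_le (u v : nat -> \bar R) : (forall n, 0 <= u n)%E ->
  (forall n, u n <= v n)%E ->
  v n @[n --> \oo] --> (0 : \bar R) -> u n @[n --> \oo] --> (0 : \bar R).
Proof.
move=> u0 uv v0; apply: (squeeze_cvge _ (cvg_cst _) v0).
by apply: nearW => n; rewrite u0 uv.
Qed.

Lemma cvge0M (u : nat -> \bar R) (k : R) :
  u n @[n --> \oo] --> (0 : \bar R) -> (k%:E * u n)%E @[n --> \oo] --> (0 : \bar R).
Proof.
by move=> u0; rewrite -(mule0 k%:E); apply: cvgeZl.
Qed.

Lemma cvge0D (u v : nat -> \bar R) :
  u n @[n --> \oo] --> (0 : \bar R) -> v n @[n --> \oo] --> (0 : \bar R) ->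
  (u n + v n)%E @[n --> \oo] --> (0 : \bar R).
Proof.
by move=> u0 v0; rewrite -(adde0 0%E); apply: cvgeD.
Qed.
End Limits.

(** An isometry between dense sets stays an isometry in the limit.  Applied to
    [f = u n + (f - u n)] and to [v n = g + (v n - g)], the weighted inequality
    bounds the square norm of [f] by [(1 + e)^2] times that of [g], up to errors
    that tend to 0 for fixed [e]. *)
Lemma L2_sqnorm_lim_le d d' (T : measurableType d) (T' : measurableType d')
    (R : realType) (mu : {measure set T -> \bar R}) (nu : {measure set T' -> \bar R})
    (u : nat -> T -> R[i]) (f : T -> R[i]) (v : nat -> T' -> R[i]) (g : T' -> R[i]) :
  (forall n, in_L2 mu setT (u n)) -> in_L2 mu setT f ->
  (forall n, in_L2 nu setT (v n)) -> in_L2 nu setT g ->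
  L2_sqnorm mu setT (u n \- f) @[n --> \oo] --> (0 : \bar R) ->
  L2_sqnorm nu setT (v n \- g) @[n --> \oo] --> (0 : \bar R) ->
  (forall n, L2_sqnorm mu setT (u n) = L2_sqnorm nu setT (v n)) ->
  (L2_sqnorm mu setT f <= L2_sqnorm nu setT g)%E.
Proof.
move=> u2 f2 v2 g2 uf vg uv.
have [M M0 gM] := in_L2_fin g2; rewrite gM.
apply/lee_addgt0Pr => eps eps0.
(* Since e <= 1, (1 + e)^2 M + e <= M + e (3 M + 1) <= M + eps. *)
pose e := Num.min 1 (eps / (3 * M + 1)).
have M1 : 0 < 3 * M + 1 by lra.
have e0 : 0 < e by rewrite lt_min ltr01 divr_gt0.
have e1 : e <= 1 by rewrite ge_min lexx.
have eM : e * (3 * M + 1) <= eps.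
  by rewrite -ler_pdivlMr// ge_min lexx orbT.
(* C collects the factors of the two error terms, which are both made smaller
   than e / C. *)
pose C := (1 + e) * (1 + e^-1) + (1 + e^-1).
have V0 : 0 < e^-1 by rewrite invr_gt0.
have C0 : 0 < C by rewrite addr_gt0// ?mulr_gt0//; lra.
have de0 : 0 < e / C by rewrite divr_gt0.
near \oo => n.
have d1 : (L2_sqnorm mu setT (u n \- f)%R < (e / C)%:E)%E.
  by near: n; exact: cvge0_lt.
have d2 : (L2_sqnorm nu setT (v n \- g)%R < (e / C)%:E)%E.
  by near: n; exact: cvge0_lt.
have [a a0 ua] := in_L2_fin (u2 n).
have va : L2_sqnorm nu setT (v n) = a%:E by rewrite -uv.
have [p p0 pE] := in_L2_fin (in_L2B measurableT (u2 n) f2).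
have [q q0 qE] := in_L2_fin (in_L2B measurableT (v2 n) g2).
have [b b0 fb] := in_L2_fin f2.
rewrite pE lte_fin in d1; rewrite qE lte_fin in d2.
have h1 : b <= (1 + e) * a + (1 + e^-1) * p.
  have := @L2_sqnormD _ _ _ mu _ _ _ _ measurableT e0 (u2 n).1
    (cmeasurableB f2.1 (u2 n).1).
  rewrite ua L2_sqnorm_sub pE (L2_sqnorm_eq mu (g := f)) ?fb.
    by rewrite -!EFinM -EFinD lee_fin.
  by move=> x _; rewrite addrC subrK.
have h2 : a <= (1 + e) * M + (1 + e^-1) * q.
  have := @L2_sqnormD _ _ _ nu _ _ _ _ measurableT e0 g2.1
    (cmeasurableB (v2 n).1 g2.1).
  rewrite gM qE (L2_sqnorm_eq nu (g := v n)) ?va.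
    by rewrite -!EFinM -EFinD lee_fin.
  by move=> x _; rewrite addrC subrK.
rewrite fb -EFinD lee_fin.
have CE : C * (e / C) = e by field; exact: lt0r_neq0.
have h3 : (1 + e) * a <= (1 + e) * ((1 + e) * M + (1 + e^-1) * q).
  by rewrite ler_pM2l//; lra.
have h4 : (1 + e) * (1 + e^-1) * q <= (1 + e) * (1 + e^-1) * (e / C).
  by apply: ler_wpM2l; [apply: mulr_ge0; lra|exact: ltW].
have h5 : (1 + e^-1) * p <= (1 + e^-1) * (e / C).
  by apply: ler_wpM2l; [lra|exact: ltW].
have h6 : e * e * M <= e * M by rewrite ler_wpM2r//; rewrite ler_piMl// ltW.
move: CE; rewrite /C => CE.
set E1 := e^-1 in h1 h2 h3 h4 h5 CE *.
set D := e / C in h4 h5 CE *.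
have : b <= (1 + e) * (1 + e) * M + ((1 + e) * (1 + E1) + (1 + E1)) * D by lra.
by rewrite CE; lra.
Unshelve. all: by end_near. Qed.

Lemma L2_sqnorm_lim d d' (T : measurableType d) (T' : measurableType d')
    (R : realType) (mu : {measure set T -> \bar R}) (nu : {measure set T' -> \bar R})
    (u : nat -> T -> R[i]) (f : T -> R[i]) (v : nat -> T' -> R[i]) (g : T' -> R[i]) :
  (forall n, in_L2 mu setT (u n)) -> in_L2 mu setT f ->
  (forall n, in_L2 nu setT (v n)) -> in_L2 nu setT g ->
  L2_sqnorm mu setT (u n \- f) @[n --> \oo] --> (0 : \bar R) ->
  L2_sqnorm nu setT (v n \- g) @[n --> \oo] --> (0 : \bar R) ->
  (forall n, L2_sqnorm mu setT (u n) = L2_sqnorm nu setT (v n)) ->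
  L2_sqnorm mu setT f = L2_sqnorm nu setT g.
Proof.
move=> u2 f2 v2 g2 uf vg uv; apply/eqP; rewrite eq_le.
rewrite (L2_sqnorm_lim_le u2 f2 v2 g2 uf vg uv)/=.
by rewrite (L2_sqnorm_lim_le v2 g2 u2 f2 vg uf (fun n => esym (uv n))).
Qed.

(** * Riesz bases supported by pieces of a measure space *)

Section RieszBases.
Context d (T : measurableType d) (R : realType).
Variable mu : {measure set T -> \bar R}.
Implicit Types (E : set T) (f g : T -> R[i]).

Lemma cmeasurableS (D E : set T) f : measurable D -> E `<=` D ->
  cmeasurable D f -> cmeasurable E f.
Proof. by move=> mD ED [f1 f2]; split; apply: measurable_funS; eauto. Qed.

Lemma eq_cmeasurable E f g : (forall x, E x -> f x = g x) ->
  cmeasurable E f -> cmeasurable E g.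
Proof.
move=> fg [f1 f2]; split.
  by apply: eq_measurable_fun f1 => x /set_mem/fg ->.
by apply: eq_measurable_fun f2 => x /set_mem/fg ->.
Qed.

Lemma cmeasurable_mul_indic E f : measurable E ->
  cmeasurable E f <-> cmeasurable setT (fun x => f x * (\1_E x)%:C).
Proof.
move=> mE; split=> [[f1 f2]|mf].
  split.
    rewrite (_ : (fun x => _) = (fun x => complex.Re (f x)) \_ E).
      exact/(measurable_restrictT _ mE).1.
    apply/funext => x; rewrite patchE indicE.
    by case: (x \in E); case: (f x) => a b /=; simpc.
  rewrite (_ : (fun x => _) = (fun x => complex.Im (f x)) \_ E).
    exact/(measurable_restrictT _ mE).1.
  apply/funext => x; rewrite patchE indicE.
  by case: (x \in E); case: (f x) => a b /=; simpc.
apply: (@eq_cmeasurable _ (fun x => f x * (\1_E x)%:C)).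
  by move=> x Ex; rewrite indicE mem_set// mulr1.
exact: (cmeasurableS measurableT).
Qed.

Lemma L2_sqnorm_mul_indic E f :
  L2_sqnorm mu setT (fun x => f x * (\1_E x)%:C) = L2_sqnorm mu E f.
Proof.
rewrite /L2_sqnorm [RHS]integral_mkcond; apply: eq_integral => x _.
rewrite patchE indicE -!/(normc2 _).
by case: (x \in E); rewrite /= ?mulr1 ?mulr0 ?normc20.
Qed.

Lemma in_L2_mul_indic E f : measurable E ->
  in_L2 mu E f <-> in_L2 mu setT (fun x => f x * (\1_E x)%:C).
Proof.
by move=> mE; rewrite /in_L2 L2_sqnorm_mul_indic cmeasurable_mul_indic.
Qed.

Lemma L2_sqnorm_indic E : measurable E ->
  L2_sqnorm mu setT (fun x => (\1_E x)%:C) = mu E.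
Proof.
move=> mE; rewrite -[E in RHS]setIT -integral_indic//.
by apply: eq_integral => x _; rewrite -/(normc2 _) normc2_real indicE;
  case: (x \in E); rewrite ?expr1n ?expr0n.
Qed.

Lemma lee0_mul_small (x : \bar R) (k : R) : 0 <= k ->
  (forall e : R, 0 < e -> (x <= (k * e)%:E)%E) -> (x <= 0)%E.
Proof.
move=> k0 h; apply/lee_addgt0Pr => e e0; rewrite add0e.
have k1 : 0 < k + 1 by lra.
apply: le_trans (h (e / (k + 1)) _) _; first by rewrite divr_gt0.
rewrite lee_fin mulrCA; apply: ler_piMr; first exact: ltW.
rewrite ler_pdivrMr// mul1r; lra.
Qed.

Lemma big_fset_image (V : nmodType) (I J : choiceType) (h : I -> J) (F : {fset I})
    (G : J -> V) : injective h ->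
  \sum_(j <- [fset h i | i in F]%fset) G j = \sum_(i <- F) G (h i).
Proof. by move=> hinj; rewrite big_imfset//= => x y _ _; exact: hinj. Qed.

(** The wavelets are indexed by [lambda] and the characters by
    [t = - alpha^-1 lambda], and they differ by a constant factor.  Such a change
    multiplies both Riesz bounds by the square modulus of the factor. *)
Lemma riesz_basis_reindex E (I J : choiceType) (D : set I) (f : I -> T -> R[i])
    (h : J -> I) (h' : I -> J) (k : R[i]) :
  measurable E -> cancel h h' -> cancel h' h -> k != 0 ->
  riesz_basis mu E D f -> riesz_basis mu E (h @^-1` D) (fun j x => k * f (h j) x).
Proof.
move=> mE hK h'K k0 [fL2 fc [a [b [a0 b0 ab]]]].
have hinj := can_inj hK; have h'inj := can_inj h'K.
split.
- by move=> j Dj; apply: in_L2Z => //; exact: fL2.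
- move=> g g2 e e0; have [F [c [FD Fc]]] := fc g g2 e e0.
  exists [fset h' i | i in F]%fset, (fun j => k^-1 * c (h j)); split.
    by move=> j /= /imfsetP[i /= iF ->]; rewrite /= h'K; exact: FD.
  rewrite (L2_sqnorm_eq mu (g := g \- lincomb f F c))// => x _ /=.
  congr (_ - _); rewrite /lincomb big_fset_image//.
  apply: eq_bigr => i _; by rewrite h'K; field.
- have nk0 : 0 < normc2 k.
    rewrite lt_neqAle normc2_ge0 andbT eq_sym sqrf_eq0.
    by apply: contra k0 => /eqP/Normc.eq0_normc ->.
  exists (a * normc2 k), (b * normc2 k); split; [exact: mulr_gt0|exact: mulr_gt0|].
  move=> F c FD.
  have [] := andP (ab [fset h j | j in F]%fset (fun i => k * c (h' i)) _).
    by move=> i /= /imfsetP[j /= jF ->]; exact: FD.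
  rewrite (L2_sqnorm_eq mu (g := lincomb (fun j x => k * f (h j) x) F c)); last first.
    move=> x _; rewrite /lincomb big_fset_image//; apply: eq_bigr => j _.
    by rewrite hK; ring.
  rewrite big_fset_image//; under eq_bigr do rewrite hK -/(normc2 _) normc2M.
  by rewrite -big_distrr /= !mulrA => -> ->.
Qed.

Section Pieces.
Variables (I J : choiceType) (L : set I) (A : set J) (E : J -> set T).
Variable e : I * J -> T -> R[i].
Hypothesis mE : forall j, measurable (E j).
Let phi (p : I * J) (x : T) : R[i] := e p x * (\1_(E p.2) x)%:C.
Hypothesis phi_basis : riesz_basis mu setT (L `*` A) phi.

Let fiber (j : J) (F : {fset I}) : {fset I * J} := [fset (i, j) | i in F]%fset.

Let big_fiber (V : nmodType) j (F : {fset I}) (G : I * J -> V) :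
  \sum_(p <- fiber j F) G p = \sum_(i <- F) G (i, j).
Proof. by rewrite big_fset_image// => x y []. Qed.

Let fiber_sub j F : A j -> [set` F] `<=` L -> [set` fiber j F] `<=` L `*` A.
Proof. by move=> Aj FL p /= /imfsetP[i /= iF ->]; split => //=; exact: FL. Qed.

Let lincomb_fiber j F (c : I * J -> R[i]) x :
  lincomb phi (fiber j F) c x =
  lincomb (fun i => e (i, j)) F (fun i => c (i, j)) x * (\1_(E j) x)%:C.
Proof.
rewrite /lincomb big_fiber mulr_suml; apply: eq_bigr => i _.
by rewrite /phi /= mulrA.
Qed.

Let phi_L2 : forall p, (L `*` A) p -> in_L2 mu setT (phi p).
Proof. by case: phi_basis. Qed.

Let lincomb_measurable (F : {fset I * J}) c : [set` F] `<=` L `*` A ->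
  cmeasurable setT (lincomb phi F c).
Proof.
move=> FLA.
have -> : lincomb phi F c =
    (fun x => \sum_(p <- F) (if p \in F then c p * phi p x else 0)).
  by apply/funext => x; apply: eq_big_seq => p /= ->.
apply: cmeasurable_sum => p; have [pF|pF] := boolP (p \in F); last exact: cmeasurable_cst.
apply: cmeasurableM; first exact: cmeasurable_cst.
exact: (phi_L2 (FLA _ pF)).1.
Qed.

(** The Riesz inequality for the functions on [E j] is the one of the whole family
    for coefficients that vanish off the index [j].  For completeness, extend [g]
    by 0 and approximate it with the whole family: almost everywhere on [E j] only
    the terms of index [j] survive, and restricting to [E j] decreases norms. *)
Lemma riesz_basis_piece j : A j ->
  {ae mu, forall x, forall j k, A j -> A k -> E j x -> E k x -> j = k} ->
  riesz_basis mu (E j) L (fun i => e (i, j)).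
Proof.
move=> Aj disj; have [_ fc [a [b [a0 b0 ab]]]] := phi_basis.
split.
- by move=> i Li; apply/in_L2_mul_indic => //; exact: (@phi_L2 (i, j)).
- move=> g g2 eps eps0.
  have [F [c [FLA Fc]]] := fc _ ((in_L2_mul_indic g (mE j)).1 g2) eps eps0.
  pose Fj := [fset p in F | p.2 == j]%fset.
  pose F1 := [fset p.1 | p in Fj]%fset.
  have F1L : [set` F1] `<=` L.
    by move=> i /= /imfsetP[p /=]; rewrite !inE => /andP[/FLA[Lp _] _] ->.
  exists F1, (fun i => c (i, j)); split => //.
  apply: le_lt_trans Fc.
  set u := (X in (_ <= L2_sqnorm _ _ X)%E).
  have mu1 : cmeasurable setT u.
    apply: cmeasurableB; last exact: lincomb_measurable.
    exact: ((cmeasurable_mul_indic g (mE j)).1 g2.1).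
  apply: (@le_trans _ _ (L2_sqnorm mu (E j) u)); last first.
    apply: ge0_subset_integral => //; first exact: measurable_normc2.
    by move=> x _; rewrite lee_fin sqr_ge0.
  have fE x : lincomb phi (fiber j F1) c x =
      \sum_(p <- F | p.2 == j) c p * phi p x.
    rewrite /lincomb [RHS]big_fset_condE; apply: eq_fbigl => -[i k].
    apply/imfsetP/idP => /=.
      move=> [i' /= /imfsetP[[i2 k2] /=]]; rewrite !inE /= => /andP[Fi2 /eqP kj] -> [-> ->].
      by rewrite -kj Fi2 kj eqxx.
    rewrite !inE /= => /andP[ikF /eqP kj]; exists i; last by rewrite kj.
    by apply/imfsetP; exists (i, k) => //=; rewrite !inE /= ikF kj eqxx.
  have mlin : cmeasurable (E j) (lincomb (fun i => e (i, j)) F1 (fun i => c (i, j))).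
    apply/cmeasurable_mul_indic => //.
    under eq_fun do rewrite -lincomb_fiber.
    by apply: lincomb_measurable; exact: fiber_sub.
  rewrite le_eqVlt; apply/orP; left; apply/eqP.
  apply: ge0_ae_eq_integral => //.
  + by apply: measurable_normc2; apply: cmeasurableB => //; exact: g2.1.
  + by apply: measurable_normc2; exact: (cmeasurableS measurableT).
  + by move=> x _; rewrite lee_fin sqr_ge0.
  + by move=> x _; rewrite lee_fin sqr_ge0.
  apply: filterS disj => x disjx Ejx; congr (_ ^+ 2)%:E; congr Normc.normc.
  rewrite /u /= indicE mem_set// mulr1; congr (_ - _).
  have := lincomb_fiber j F1 c x; rewrite indicE mem_set// mulr1 => <-.
  rewrite fE /lincomb [RHS](bigID (fun p => p.2 == j)) /=.
  rewrite [X in _ = _ + X]big1_seq ?addr0// => p /andP[pj pF].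
  rewrite /phi indicE memNset ?mulr0// => Epx.
  have [_ Ap] := FLA _ pF.
  by move/eqP: pj; apply; exact: disjx.
- exists a, b; split => // F c FL.
  have := ab (fiber j F) (fun p => c p.1) (fiber_sub Aj FL).
  rewrite big_fiber /= (L2_sqnorm_eq mu (fun x _ => lincomb_fiber j F (fun p => c p.1) x)).
  by rewrite L2_sqnorm_mul_indic.
Qed.

(** On [T] as on [E j], the approximation error is the same, since the indicator
    function and the combination both vanish off [E j]. *)
Lemma riesz_piece_approx j S eps : A j -> 0 < eps -> measurable S -> S `<=` E j ->
  (mu (E j) < +oo)%E -> riesz_basis mu (E j) L (fun i => e (i, j)) ->
  exists (F : {fset I}) (c : I * J -> R[i]), [set` F] `<=` L /\
    (L2_sqnorm mu setT
      ((fun x => (\1_S x)%:C) \- lincomb phi (fiber j F) c)%R < eps%:E)%E.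
Proof.
move=> Aj eps0 mS SE Eoo [_ fc _].
have S2 : in_L2 mu (E j) (fun x => (\1_S x)%:C : R[i]).
  split; first exact: cmeasurable_indic.
  rewrite -L2_sqnorm_mul_indic.
  rewrite (L2_sqnorm_eq mu (g := fun x => (\1_S x)%:C)).
    by rewrite L2_sqnorm_indic//; apply: le_lt_trans Eoo; apply: le_measure; rewrite ?inE.
  move=> x _; rewrite !indicE; have [xS|xS] := boolP (x \in S); last by rewrite mul0r.
  by rewrite (mem_set (SE _ (set_mem xS))) mulr1.
have [F [c [FL Fc]]] := fc _ S2 eps eps0.
exists F, (fun p => c p.1); split => //.
rewrite -L2_sqnorm_mul_indic in Fc; apply: le_lt_trans Fc.
rewrite le_eqVlt; apply/orP; left; apply/eqP; apply: L2_sqnorm_eq => x _ /=.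
rewrite lincomb_fiber mulrBl; congr (_ - _).
rewrite !indicE; have [xS|xS] := boolP (x \in S); last by rewrite mul0r.
by rewrite (mem_set (SE _ (set_mem xS))) mulr1.
Qed.

(** The coefficients of the combinations on [E j] and on [E k] are distinct
    coefficients of one combination of the whole family, which is the difference
    of two functions close to the indicator of the intersection.  The lower Riesz
    bound makes them small, and the upper one then makes the indicator small. *)
Lemma riesz_pieces_disjoint j k : A j -> A k -> j != k ->
  (mu (E j) < +oo)%E -> (mu (E k) < +oo)%E ->
  riesz_basis mu (E j) L (fun i => e (i, j)) ->
  riesz_basis mu (E k) L (fun i => e (i, k)) ->
  mu (E j `&` E k) = 0%E.
Proof.
move=> Aj Ak jk joo koo bj bk.
have [_ _ [a [b [a0 b0 ab]]]] := phi_basis.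
set S := E j `&` E k; have mS : measurable S by exact: measurableI.
apply/eqP; rewrite eq_le measure_ge0 andbT.
apply: (@lee0_mul_small _ (2 * (1 + b * (4 / a)))).
  by rewrite mulr_ge0// addr_ge0// mulr_ge0// ?divr_ge0// ltW.
move=> eps eps0.
have [F1 [c1 [F1L h1]]] := riesz_piece_approx Aj eps0 mS (@subIsetl _ _ _) joo bj.
have [F2 [c2 [F2L h2]]] := riesz_piece_approx Ak eps0 mS (@subIsetr _ _ _) koo bk.
pose h (x : T) : R[i] := (\1_S x)%:C.
have mh : cmeasurable setT h by exact: cmeasurable_indic.
set p := lincomb phi (fiber j F1) c1 in h1.
set q := lincomb phi (fiber k F2) c2 in h2.
have mp : cmeasurable setT p by apply: lincomb_measurable; exact: fiber_sub.
have mq : cmeasurable setT q by apply: lincomb_measurable; exact: fiber_sub.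
pose F := (fiber j F1 `|` fiber k F2)%fset.
(* With these coefficients the combination over F is p - q. *)
pose c (r : I * J) := if r.2 == j then c1 r else - c2 r.
have Fj : [fset r in F | r.2 == j]%fset = fiber j F1.
  apply/fsetP => -[i l]; rewrite !inE /=; apply/andP/idP => [[/orP[//|]]|iF].
    by move=> /imfsetP[i' /= _ [_ ->]]; rewrite eq_sym (negbTE jk).
  by rewrite iF; case/imfsetP : iF => i' /= _ [_ ->]; rewrite eqxx.
have Fk : [fset r in F | r.2 != j]%fset = fiber k F2.
  apply/fsetP => -[i l]; rewrite !inE /=; apply/andP/idP => [[/orP[|//]]|iF].
    by move=> /imfsetP[i' /= _ [_ ->]]; rewrite eqxx.
  by rewrite iF orbT; case/imfsetP : iF => i' /= _ [_ ->]; rewrite eq_sym.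
have sumF (V : nmodType) (G : I * J -> V) : \sum_(r <- F) G r =
    \sum_(i <- F1) G (i, j) + \sum_(i <- F2) G (i, k).
  by rewrite (big_fsetID _ (fun r => r.2 == j)) Fj Fk !big_fiber.
have FLA : [set` F] `<=` L `*` A.
  by move=> r /=; rewrite inE => /orP[]; exact: fiber_sub.
have pq x : lincomb phi F c x = (p x - h x) + (h x - q x).
  rewrite addrA subrK /lincomb sumF /p /q /lincomb !big_fiber -sumrN.
  congr (_ + _); apply: eq_bigr => i _; rewrite /c /=; first by rewrite eqxx.
  by rewrite eq_sym (negbTE jk) mulNr.
have h4 : (L2_sqnorm mu setT (lincomb phi F c) <= (4 * eps)%:E)%E.
  rewrite (L2_sqnorm_eq mu (fun x _ => pq x)).
  apply: (le_trans (L2_sqnormD2 _ _ (cmeasurableB mp mh) (cmeasurableB mh mq))) => //.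
  rewrite (_ : (4 * eps)%:E = (2%:E * (eps%:E + eps%:E))%E).
    by rewrite lee_pmul2l ?lte_fin// L2_sqnorm_sub leeD// ltW.
  by rewrite -EFinD -EFinM; congr _%:E; ring.
have [low _] := andP (ab F c FLA).
have [_ upp] := andP (ab (fiber j F1) c1 (fiber_sub Aj F1L)).
have := le_trans low h4; rewrite lee_fin sumF => low'.
set s1 := (X in a * (X + _)) in low'.
set s2 := (X in a * (_ + X)) in low'.
have s20 : 0 <= s2 by apply: sumr_ge0 => i _; exact: sqr_ge0.
have s1E : \sum_(r <- fiber j F1) Normc.normc (c1 r) ^+ 2 = s1.
  by rewrite big_fiber; apply: eq_bigr => i _; rewrite /c /= eqxx.
rewrite s1E -/p in upp.
have s1eps : s1 <= 4 / a * eps.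
  rewrite mulrAC ler_pdivlMr// mulrC; apply: le_trans low'.
  by rewrite ler_pM2l// lerDl.
rewrite -L2_sqnorm_indic// -/h.
have -> : L2_sqnorm mu setT (fun x => (\1_S x)%:C) =
    L2_sqnorm mu setT (fun x => (h x - p x) + p x).
  by apply: L2_sqnorm_eq => x _; rewrite subrK.
apply: (le_trans (L2_sqnormD2 _ _ (cmeasurableB mh mp) mp)) => //.
rewrite -mulrA EFinM lee_pmul2l ?lte_fin// mulrDl mul1r EFinD.
apply: leeD; first exact: ltW.
apply: (le_trans upp); rewrite lee_fin -mulrA ler_pM2l//.
Qed.

(** Off the pieces every combination vanishes, so no combination approaches the
    indicator of a set of positive finite measure that avoids them. *)
Lemma riesz_pieces_cover : countable A -> sigma_finite setT mu ->
  {ae mu, forall x, exists2 j, A j & E j x}.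
Proof.
move=> cA [B TB mB]; have [_ fc _] := phi_basis.
pose U := \bigcup_(j in A) E j.
have mU : measurable U by exact: measurable_bigcup_countable.
have UB0 n : mu (B n `\` U) = 0%E.
  have mS : measurable (B n `\` U) by apply: measurableD => //; exact: (mB n).1.
  have Soo : (mu (B n `\` U) < +oo)%E.
    apply: le_lt_trans (mB n).2; apply: le_measure; rewrite ?inE//; exact: (mB n).1.
  apply/eqP; rewrite eq_le measure_ge0 andbT.
  apply: (@lee0_mul_small _ 1) => // eps eps0; rewrite mul1r.
  have S2 : in_L2 mu setT (fun x => (\1_(B n `\` U) x)%:C : R[i]).
    by split; [exact: cmeasurable_indic|rewrite L2_sqnorm_indic].
  have [F [c [FLA Fc]]] := fc _ S2 eps eps0.
  apply: le_trans (ltW Fc); rewrite -L2_sqnorm_indic//.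
  apply: L2_sqnorm_le => //; first exact: cmeasurable_indic.
    by apply: cmeasurableB; [exact: cmeasurable_indic|exact: lincomb_measurable].
  move=> x _ /=; rewrite {1}indicE; have [xS|xS] := boolP (x \in _); last first.
    by rewrite normc20 normc2_ge0.
  rewrite indicE xS (_ : lincomb phi F c x = 0) ?subr0//.
  rewrite /lincomb big1_seq// => p /= pF; rewrite /phi indicE memNset ?mulr0// => Epx.
  have [_ nU] := set_mem xS; apply: nU; exists p.2 => //.
  exact: (FLA _ pF).2.
have : mu.-negligible (\bigcup_n (B n `\` U)).
  apply: negligible_bigcup => n; apply/negligibleP; last exact: UB0.
  by apply: measurableD => //; exact: (mB n).1.
move=> N; change (mu.-negligible (~` [set x | exists2 j, A j & E j x])).
apply: negligibleS N => x nx.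
have [n _ Bnx] : (\bigcup_n B n) x by rewrite -TB.
by exists n => //; split => // -[j Aj Ejx]; apply: nx; exists j.
Qed.

End Pieces.
End RieszBases.

(** * The topology of the dual group *)

Section DualTopology.
Variables (R : realType) (G : topologicalZmodType).
Implicit Types xi eta : dual R G.

Lemma dual_cvg_compact_open (F : set_system (dual R G)) xi : Filter F ->
  F --> xi <->
  {compact-open, (@dual_to_fun R G @ F) --> (dual_to_fun xi)}.
Proof.
move=> FF; split => [Fxi|Fxi].
  apply: cvg_trans (@initial_continuous _ _ (@dual_to_fun R G) xi).
  exact: cvg_app Fxi.
move=> A [/= B [[C oC CB] Bxi BA]].
apply: filterS BA _.
have /Fxi : nbhs (dual_to_fun xi) C.
  by apply: open_nbhs_nbhs; split => //; move: Bxi; rewrite -CB.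
by rewrite /= -CB; exact.
Qed.

(** On continuous functions the compact-open topology is that of uniform
    convergence on compact sets.  In this form the continuity of the group
    operations is a matter of estimates. *)
Lemma dual_cvgP (F : set_system (dual R G)) xi : Filter F ->
  F --> xi <->
  forall K, compact K -> forall e : R[i], 0 < e ->
    F [set eta : dual R G | forall x, K x -> `|eta x - xi x| < e].
Proof.
move=> FF; rewrite dual_cvg_compact_open.
pose f : G -> R[i]^o := dual_to_fun xi.
have fc : continuous f by exact: char_continuous.
have FF' : Filter (@dual_to_fun R G @ F) by exact: fmap_filter.
have -> := @compact_open_fam_compactP G R[i]^o f (@dual_to_fun R G @ F) fc FF'.
rewrite fam_cvgP; split => h K cK.
  move=> e e0.
  have hN : nbhs (f : {uniform` K -> R[i]^o})
      [set g : G -> R[i]^o | forall y, K y -> `|g y - f y| < e].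
    apply/uniform_nbhs; exists [set xy : R[i]^o * R[i]^o | `|xy.2 - xy.1| < e].
    split => //; rewrite -entourage_ballE; exists e => // xy /=.
    by rewrite /ball /= distrC.
  exact: (h K cK _ hN).
move=> A /uniform_nbhs[E [entE EA]].
move: entE; rewrite -entourage_ballE => -[e e0 eE].
have H := h K cK e e0; change (F (@dual_to_fun R G @^-1` A)).
apply: filterS H => eta etaK /=.
apply: EA => x Kx /=; apply: eE; rewrite /= /ball /= distrC.
exact: etaK.
Qed.


Lemma dual_nbhs xi (K : set G) (e : R[i]) : compact K -> 0 < e ->
  nbhs xi [set eta : dual R G | forall x, K x -> `|eta x - xi x| < e].
Proof.
move=> cK e0.
have FF : Filter (nbhs xi) by exact: nbhs_filter.
have H := @dual_cvgP (nbhs xi) xi FF.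
exact: (H.1 (fun A => id) K cK e e0).
Qed.

Lemma dual_eval_continuous (x : G) : continuous (fun xi : dual R G => xi x : R[i]^o).
Proof.
move=> xi; have FF : Filter (nbhs xi) by exact: nbhs_filter.
apply/cvgrPdist_lt => e e0.
have := dual_nbhs xi (@compact_set1 _ x) e0.
by apply: filterS => eta /(_ x erefl); rewrite distrC.
Qed.

Lemma adjoint_continuous (alpha : aut G) :
  continuous (@adjoint G R alpha).
Proof.
move=> xi; have FF : Filter (nbhs xi) by exact: nbhs_filter.
apply/dual_cvgP => K cK e e0.
have cK' : compact (alpha @` K).
  apply: continuous_compact => //; apply: continuous_subspaceT.
  exact: aut_continuous.
have := dual_nbhs xi cK' e0; apply: filterS => eta etaK x Kx /=.
by apply: etaK; exists x.
Qed.

(** The subtraction of characters is the quotient of functions of modulus 1, for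
    which [|a / b - a' / b'| <= |a - a'| + |b - b'|]. *)
Lemma dual_sub_continuous :
  continuous (fun p : dual R G * dual R G => p.1 - p.2).
Proof.
move=> [xi eta] /=; apply/dual_cvgP => K cK e e0.
have e20 : 0 < e / 2 by rewrite divr_gt0.
have h1 := dual_nbhs xi cK e20; have h2 := dual_nbhs eta cK e20.
exists ([set z : dual R G | forall x, K x -> `|z x - xi x| < e / 2],
        [set z : dual R G | forall x, K x -> `|z x - eta x| < e / 2]) => //.
move=> [xi' eta'] /= [h1' h2'] x Kx.
rewrite /= (_ : _ - _ = (xi' x - xi x) / eta' x +
  xi x / (eta x * eta' x) * (eta x - eta' x)); last first.
  by field; rewrite !char_neq0.
rewrite [e]splitr (le_lt_trans (ler_normD _ _))// ltrD//.
  by rewrite normrM normfV char_norm invr1 mulr1; exact: h1'.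
by rewrite !normrM normfV normrM !char_norm mulr1 invr1 !mul1r distrC h2'.
Qed.
End DualTopology.

Section CountableSubbase.
Variables (X : topologicalType) (S : set (set X)).

Definition subbase_filter (x : X) : set_system X :=
  filter_from [set U | finI_from S id U /\ U x] id.

Lemma subbase_filterP x : Filter (subbase_filter x).
Proof.
apply: filter_from_filter.
  exists setT; split => //; exists fset0 => //.
  by rewrite set_fset0 bigcap_set0.
move=> U V [SU Ux] [SV Vx]; exists (U `&` V) => //.
by split => //; exact: finI_fromI.
Qed.

Lemma subbase_filter1 x U : S U -> U x -> subbase_filter x U.
Proof.
by move=> SU Ux; exists U => //; split => //; exact: (@finI_from1 _ _ S id U).
Qed.

(** The finite intersections of members of a countable family form a countable
    family. *)
Lemma second_countable_subbase : countable S -> S `<=` open ->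
  (forall x, subbase_filter x --> x) -> @second_countable X.
Proof.
move=> cS oS Sx; exists (finI_from S id); first exact: finI_from_countable.
split => // _ [F FS <-]; rewrite bigcap_fset.
rewrite big_seq; apply: big_rec => [|U V UF oV]; first exact: openT.
by apply: openI => //; apply: oS; exact/set_mem/FS.
Qed.

End CountableSubbase.

Lemma complex_second_countable (R : realType) : @second_countable R[i]^o.
Proof.
pose f (t : rat * rat * rat) : set R[i]^o :=
  ball ((ratr t.1.1 +i* ratr t.1.2 : R[i]) : R[i]^o) ((ratr t.2 : R)%:C).
exists (f @` [set: rat * rat * rat]).
  apply: (sub_countable (card_image_le _ _)); exact: countableP.
split; first by move=> _ [t _ <-]; exact: ball_open.
move=> z V /nbhs_ballP[[r r'] /=]; rewrite ltcE /= => /andP[/eqP -> r0] zV.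
have r20 : 0 < r / 2 by rewrite divr_gt0.
have [q] := rat_in_itvoo r20.
rewrite in_itv /= => /andP[q0 qr].
have near_rat (x : R) : exists a : rat, `|x - ratr a| < ratr q / 2.
  have xq : x < x + ratr q / 2 by rewrite ltrDl divr_gt0.
  have [a] := rat_in_itvoo xq.
  rewrite in_itv /= => /andP[xa ax]; exists a.
  by rewrite ltr0_norm ?subr_lt0// opprB ltrBlDl.
have [a za] := near_rat (complex.Re z); have [b zb] := near_rat (complex.Im z).
pose w : R[i]^o := (ratr a +i* ratr b).
have wz : `|(w : R[i]) - z| < (ratr q)%:C.
  have -> : w - z = (ratr a - complex.Re z)%:C + 'i%C * (ratr b - complex.Im z)%:C.
    by case: (z) => x y; simpc.
  rewrite (le_lt_trans (ler_normD _ _))// normrM.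
  rewrite !normc_def /= !expr0n /= !addr0 expr1n add0r sqrtr1 mul1r.
  rewrite !sqrtr_sqr -rmorphD /= ltcR.
  by rewrite [ltRHS]splitr ltrD// distrC.
exists (f (a, b, q)).
  by split; [exists (a, b, q)|rewrite /f/= /ball/=].
move=> y; rewrite /f/= /ball /= => wy; apply: zV; rewrite /ball /=.
rewrite (_ : z - y = (z - w) + (w - y)); last by rewrite addrA subrK.
rewrite (le_lt_trans (ler_normD _ _))//.
apply: (lt_trans (ltrD _ wy)); first by rewrite distrC; exact: wz.
rewrite -rmorphD /= ltcR; lra.
Qed.


Section DualSecondCountable.
Variables (R : realType) (G : topologicalZmodType).
Hypothesis G_hausdorff : hausdorff_space G.
Hypothesis G_locally_compact : locally_compact [set: G].
Hypothesis G_second_countable : @second_countable G.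

Lemma compact_closure_basis (B : set (set G)) (x : G) (V : set G) :
  basis B -> nbhs x V ->
  exists U, [/\ B U, U x, compact (closure U) & closure U `<=` V].
Proof.
move=> [oB Bx] Vx.
have [K] := G_locally_compact (x := x) I.
rewrite withinET => Kx [cK clK].
have [W Wx WV] := compact_regular G_hausdorff cK Kx Vx.
have [U [BU Ux] UW] := Bx x (W `&` K) (filterI Wx Kx).
exists U; split => //.
  apply: (subclosed_compact _ cK); first exact: closed_closure.
  rewrite ((closure_id K).1 clK); apply: closure_subset.
  by move=> y /UW [].
by apply: subset_trans WV; apply: closure_subset => y /UW [].
Qed.

(** A countable subbase consists of the sets of the characters that map the closure
    of a basic open set [U] of [G], when it is compact, into a basic open set of
    the complex plane: a character that maps a compact [K] into an open [O] maps
    the closures of finitely many such [U] covering [K] into basic open subsets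
    of [O]. *)
Lemma dual_second_countable : @second_countable (dual R G).
Proof.
have [B cB Bb] := G_second_countable.
have [C cC Cb] := complex_second_countable R.
pose D := (B `*` C) `&` [set UW | compact (closure UW.1)].
pose s (UW : set G * set R[i]^o) : set (dual R G) :=
  [set xi : dual R G | (xi : G -> R[i]^o) @` closure UW.1 `<=` UW.2].
apply: (@second_countable_subbase _ (s @` D)).
- apply: (card_le_trans (card_image_le _ _)).
  apply: (sub_countable _ (countableX cB cC)).
  by apply: subset_card_le; exact: subIsetl.
- move=> _ [[U W] [[/= BU CW] cU] <-].
  exists [set g : {compact-open, G -> R[i]^o} | g @` closure U `<=` W] => //.
  by apply: compact_open_open => //; exact: Cb.1.
move=> xi; have FF := subbase_filterP (s @` D) xi.
apply/dual_cvg_compact_open/compact_open_cvgP => K O cK oO xiKO.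
have : subbase_filter (s @` D) xi [set eta : dual R G | K `<=` [set x | O (eta x)]].
  apply: ((compact_near_coveringP K).1 cK _ _
    (fun (eta : dual R G) x => O (eta x)) FF) => x Kx.
  have Ox : nbhs (xi x : R[i]^o) O.
    by apply: open_nbhs_nbhs; split => //; apply: xiKO; exists x.
  have [W [CW Wx] WO] := Cb.2 (xi x) O Ox.
  have xiW : nbhs x ((xi : G -> R[i]^o) @^-1` W).
    apply: char_continuous; apply: open_nbhs_nbhs; split => //; exact: Cb.1.
  have [U [BU Ux cU UW]] := compact_closure_basis Bb xiW.
  exists (U, s (U, W)).
    split => /=; first by apply: open_nbhs_nbhs; split => //; exact: Bb.1.
    apply: subbase_filter1; first by exists (U, W).
    by move=> y [z Uz <-]; exact: UW.
  move=> [y eta] /= [Uy sWeta]; apply: WO; apply: sWeta.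
  by exists y => //; exact: subset_closure.
by apply: filterS => eta etaK _ [x Kx <-]; exact: etaK.
Qed.

End DualSecondCountable.

(** * Haar measure on the dual group and automorphisms *)

Lemma borel_open (X : PreTopologicalZmodule.type) (U : set X) :
  open U -> measurable (U : set (borel X)).
Proof. by move=> oU; apply: sub_sigma_algebra. Qed.

Lemma borel_continuous (X Y : PreTopologicalZmodule.type) (f : X -> Y) :
  continuous f -> measurable_fun [set: borel X] (f : borel X -> borel Y).
Proof.
move=> /continuousP fc; apply: (@measurability _ _ (borel X) (borel Y) _ _ open) => //.
by move=> _ [U oU <-]; rewrite setTI; apply: borel_open; exact: fc.
Qed.

Lemma borel_continuousR (R : realType) (X : PreTopologicalZmodule.type) (f : X -> R) :
  continuous f -> measurable_fun [set: borel X] (f : borel X -> R).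
Proof.
move=> /continuousP fc.
apply: (measurability _ (RGenOInfty.measurableE R)) => //.
move=> _ [_ [x ->] <-]; rewrite setTI; apply: borel_open; apply: fc.
exact: rray_open.
Qed.

(** The product sigma-algebra contains the open rectangles but not, in general,
    every open set of the product.  It does if the topology has a countable basis,
    because an open set is then a countable union of rectangles. *)
Lemma borel_continuous2 (X Y : PreTopologicalZmodule.type) (f : X * X -> Y) :
  @second_countable X -> continuous f ->
  measurable_fun [set: borel X * borel X] (f : borel X * borel X -> borel Y).
Proof.
move=> [B cB [Bo Bn]] /continuousP fc.
apply: (@measurability _ _ _ (borel Y) _ _ open) => //.
move=> _ [U oU <-]; rewrite setTI.
pose D := (B `*` B) `&` [set UV : set X * set X | UV.1 `*` UV.2 `<=` f @^-1` U].
have -> : f @^-1` U = \bigcup_(UV in D) (UV.1 `*` UV.2).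
  apply/seteqP; split=> [[x y] /= Ufxy|p [UV [_ UVU] /UVU]//].
  have : nbhs (x, y) (f @^-1` U) by apply: open_nbhs_nbhs; split => //; exact: fc.
  case=> -[V W] /= [/Bn[V' [BV' V'x] V'V] /Bn[W' [BW' W'y] W'W]] VWU.
  exists (V', W') => //; split => // -[a b] /= [/V'V Va /W'W Wb].
  exact: VWU.
apply: measurable_bigcup_countable.
  apply: (sub_countable _ (countableX cB cB)).
  by apply: subset_card_le; exact: subIsetl.
move=> [V W] [[/= /Bo oV /Bo oW] _].
by apply: measurableX; exact: borel_open.
Qed.

Lemma integral_xsection_ysection d d' (S : measurableType d) (T : measurableType d')
    (R : realType) (mu : {sigma_finite_measure set S -> \bar R})
    (nu : {sigma_finite_measure set T -> \bar R}) (W : set (S * T)) :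
  measurable W ->
  (\int[mu]_x nu (xsection W x) = \int[nu]_y mu (ysection W y))%E.
Proof.
move=> mW; have := indic_fubini_tonelli mu nu mW.
by rewrite indic_fubini_tonelli_FE// indic_fubini_tonelli_GE.
Qed.

Definition translation_invariant (R : realType) (X : PreTopologicalZmodule.type)
    (mu : set (borel X) -> \bar R) :=
  forall (x : X) (E : set (borel X)), measurable E ->
    mu [set x + y | y in (E : set X)] = mu E.

Section InvariantMeasures.
Variables (R : realType) (X : PreTopologicalZmodule.type).
Hypothesis measurable_sub : measurable_fun [set: borel X * borel X]
  ((fun p : X * X => p.1 - p.2) : borel X * borel X -> borel X).

Let measurable_subl (z : X) : measurable_fun [set: borel X]
  ((fun x : X => z - x) : borel X -> borel X).
Proof.
exact: (measurableT_comp measurable_sub (@measurable_pair1 _ _ (borel X) (borel X) z)).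
Qed.

Let measurable_add : measurable_fun [set: borel X * borel X]
  ((fun p : X * X => p.1 + p.2) : borel X * borel X -> borel X).
Proof.
have -> : (fun p : X * X => p.1 + p.2) =
    (fun p : X * X => p.1 - p.2) \o (fun p => (p.1, 0 - p.2)).
  by apply/funext => p /=; rewrite sub0r opprK.
apply: (measurableT_comp measurable_sub).
apply/measurable_fun_pairP; split => /=; first exact: measurable_fst.
exact: (measurableT_comp (measurable_subl 0) measurable_snd).
Qed.

Lemma preimage_addl (z : X) (E : set X) :
  [set x | E (z + x)] = [set - z + y | y in E].
Proof.
apply/seteqP; split=> [x Ezx|_ [y Ey <-] /=]; last by rewrite addNKr.
by exists (z + x) => //; rewrite addKr.
Qed.

Lemma measurable_opp_set (F : set (borel X)) : measurable F ->
  measurable ([set x : X | (F : set X) (- x)] : set (borel X)).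
Proof.
move=> mF; have := measurable_subl 0 measurableT mF.
by rewrite setTI; congr measurable; apply/funext => x /=; rewrite /preimage/= sub0r.
Qed.

(** Tonelli's theorem for the set of the pairs [(x, y)] with [x] in [E] and [x - y]
    in [F].  Integrating over [y] first gives the left-hand side.  For fixed [y],
    translation by [- y] turns the set of the [x] into the set of the [z] in [F]
    with [z + y] in [E]; integrating this over [y] first gives the right-hand
    side. *)
Lemma translation_invariant_proportional
    (mu nu : {sigma_finite_measure set (borel X) -> \bar R}) (E F : set (borel X)) :
  translation_invariant mu -> translation_invariant nu ->
  measurable E -> measurable F ->
  (mu E * nu [set x : X | (F : set X) (- x)%R] = nu E * mu F)%E.
Proof.
move=> muT nuT mE mF.
have mNF := measurable_opp_set mF.
pose W := ([set p | (E : set X) p.1 /\ (F : set X) (p.1 - p.2)] :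
  set (borel X * borel X)).
have mW : measurable W.
  apply: measurableI; last by rewrite -[X in measurable X]setTI; exact: measurable_sub.
  by rewrite -[X in measurable X]setTI; exact: (@measurable_fst _ _ (borel X) (borel X)).
pose V := ([set p | (F : set X) p.1 /\ (E : set X) (p.1 + p.2)] :
  set (borel X * borel X)).
have mV : measurable V.
  apply: measurableI; last by rewrite -[X in measurable X]setTI; exact: measurable_add.
  by rewrite -[X in measurable X]setTI; exact: (@measurable_fst _ _ (borel X) (borel X)).
have WE : (\int[mu]_x nu (xsection W x) =
    mu E * nu [set x : X | (F : set X) (- x)%R])%E.
  rewrite muleC -integral_cst//= [RHS]integral_mkcond/=.
  apply: eq_integral => x _; rewrite patchE.
  case: ifPn => [/set_mem Ex|/negP xE].
    rewrite -(nuT x _ mNF); congr (nu _); apply/seteqP; split=> y.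
      move/xsectionP => [_ /= Fxy]; exists (y - x); last by rewrite addrC subrK.
      by rewrite /= opprB.
    move=> [z /= Fz <-]; apply/xsectionP; split => //=.
    by rewrite opprD addrA subrr sub0r.
  rewrite (_ : xsection W x = set0) ?measure0//.
  by rewrite -subset0 => y /xsectionP[/= Ex _]; apply: xE; exact/mem_set.
have VE : (\int[mu]_x nu (xsection V x) = nu E * mu F)%E.
  rewrite -integral_cst//= [RHS]integral_mkcond/=.
  apply: eq_integral => x _; rewrite patchE.
  case: ifPn => [/set_mem Fx|/negP xF].
    rewrite -(nuT (- x) _ mE) -preimage_addl; congr (nu _).
    by apply/seteqP; split=> y; [move/xsectionP => []|move=> Exy; apply/xsectionP].
  rewrite (_ : xsection V x = set0) ?measure0//.
  by rewrite -subset0 => y /xsectionP[/= Fx _]; apply: xF; exact/mem_set.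
rewrite -WE -VE !integral_xsection_ysection//; apply: eq_integral => y _.
have mVy : measurable (ysection V y) by exact: measurable_ysection.
rewrite -(muT y _ mVy); congr (mu _); apply/seteqP; split=> x.
  move=> /ysectionP[/= Ex Fxy]; exists (x - y); last by rewrite addrC subrK.
  by apply/ysectionP; rewrite /V /= subrK.
move=> [z /ysectionP[/= Fz Ezy] <-]; apply/ysectionP; rewrite /W /=.
by rewrite addrC addrK.
Qed.

End InvariantMeasures.

Lemma pushforward_measure_exists d d' (T : measurableType d) (T' : measurableType d')
    (R : realType) (mu : {measure set T -> \bar R}) (f : T -> T') :
  measurable_fun setT f ->
  exists nu : {measure set T' -> \bar R}, nu = pushforward mu f :> (set T' -> \bar R).
Proof.
move=> mf.
unshelve eexists (pushforward mu f : {measure set T' -> \bar R}).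
- exact: mf.
- by [].
Qed.

Lemma sigma_finite_positive_set d (T : measurableType d) (R : realType)
    (mu : {measure set T -> \bar R}) :
  sigma_finite setT mu -> mu setT != 0%E ->
  exists E, [/\ measurable E, (0 < mu E)%E & (mu E < +oo)%E].
Proof.
move=> [F TF mF] muT; apply: contrapT => nE.
have F0 i : mu.-negligible (F i).
  apply/negligibleP; first exact: (mF i).1.
  apply/eqP; rewrite eq_le measure_ge0 andbT leNgt; apply/negP => Fi.
  by apply: nE; exists (F i); split; [exact: (mF i).1|exact: Fi|exact: (mF i).2].
have := negligible_bigcup F0; rewrite -TF.
by move=> /negligibleP => /(_ measurableT)/eqP; exact/negP.
Qed.

Section SigmaFinite.
Context d (T : measurableType d) (R : realType).
Variable mu : {measure set T -> \bar R}.
Hypothesis mu_fin : sigma_finite setT mu.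

(** A copy of [mu] that carries a proof of sigma-finiteness, so that the structure
    of sigma-finite measure can be attached to it. *)
Definition with_sigma_finite := let _ := mu_fin in (mu : set T -> \bar R).
HB.instance Definition _ := Measure.on with_sigma_finite.
HB.instance Definition _ := @Measure_isSigmaFinite.Build _ _ _ with_sigma_finite mu_fin.
End SigmaFinite.
(** Taking [nu = mu] in [translation_invariant_proportional] shows that [mu] is
    invariant under [x |-> - x].  The relation then reads
    [mu U * nu F = nu U * mu F] for a set [U] with [mu U] positive and finite, and
    a set of positive finite measure for [nu] shows that [nu U] is positive and
    finite too. *)
Lemma translation_invariant_unique (R : realType) (X : PreTopologicalZmodule.type)
    (mu nu : {measure set (borel X) -> \bar R}) :
  measurable_fun [set: borel X * borel X]
    ((fun p : X * X => p.1 - p.2) : borel X * borel X -> borel X) ->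
  sigma_finite setT mu -> sigma_finite setT nu ->
  translation_invariant mu -> translation_invariant nu ->
  mu setT != 0%E -> nu setT != 0%E ->
  exists2 c : R, 0 < c & forall E, measurable E -> nu E = (c%:E * mu E)%E.
Proof.
move=> msub mufin nufin muT nuT mu0 nu0.
pose mu' : {sigma_finite_measure set (borel X) -> \bar R} := with_sigma_finite mufin.
pose nu' : {sigma_finite_measure set (borel X) -> \bar R} := with_sigma_finite nufin.
have prop E F (mE : measurable E) (mF : measurable F) :=
  translation_invariant_proportional (mu := mu') (nu := nu') msub muT nuT mE mF.
have propmu E F (mE : measurable E) (mF : measurable F) :=
  translation_invariant_proportional (mu := mu') (nu := mu') msub muT muT mE mF.
have [U [mU U0 Uoo]] := sigma_finite_positive_set mufin mu0.
have [V [mV V0 Voo]] := sigma_finite_positive_set nufin nu0.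
have oppmu (F : set (borel X)) : measurable F ->
    mu [set x : X | (F : set X) (- x)%R] = mu F.
  move=> mF; have := propmu U F mU mF => /= /eqP.
  by rewrite eq_le !lee_pmul2l ?ge0_fin_numE// -eq_le => /eqP.
have propnu (F : set (borel X)) : measurable F -> (mu U * nu F = nu U * mu F)%E.
  move=> mF; have mF' := measurable_opp_set msub mF.
  have /= := prop U _ mU mF'; rewrite oppmu// => <-; congr (_ * nu _)%E.
  by apply/seteqP; split=> x /=; rewrite opprK.
have muU : mu U = (fine (mu U))%:E by rewrite fineK// ge0_fin_numE.
have u0 : 0 < fine (mu U) by rewrite -lte_fin -muU.
have nuUV : (0 < nu U * mu V < +oo)%E.
  by rewrite -propnu// mule_gt0//= lte_mul_pinfty// ?ge0_fin_numE// ltW.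
have nuU0 : (0 < nu U)%E.
  by rewrite lt0e measure_ge0 andbT; apply/eqP => nuU; move: nuUV; rewrite nuU mul0e ltxx.
have muV0 : (0 < mu V)%E.
  by rewrite lt0e measure_ge0 andbT; apply/eqP => nuU; move: nuUV; rewrite nuU mule0 ltxx.
have nuUoo : (nu U < +oo)%E.
  rewrite ltey; apply/eqP => nuU.
  by move: nuUV; rewrite nuU gt0_mulye// ltxx andbF.
have nuU : nu U = (fine (nu U))%:E by rewrite fineK// ge0_fin_numE.
exists (fine (nu U) / fine (mu U)).
  by rewrite divr_gt0// -lte_fin -nuU.
move=> E mE; have := propnu E mE; rewrite nuU muU => h.
rewrite mulrC EFinM -muleA -h muleA -EFinM mulVf ?mul1e//.
exact: lt0r_neq0.
Qed.

(** By outer regularity the compact set [{0}] has an open neighbourhood of finite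
    measure.  Its translates cover the group, so the sets of finite measure in a
    countable basis cover it as well. *)
Lemma haar_sigma_finite (R : realType) (X : PreTopologicalZmodule.type)
    (mu : {measure set (borel X) -> \bar R}) :
  @second_countable X -> closed [set (0 : X)] ->
  continuous (fun p : X * X => p.1 - p.2) ->
  is_haar mu -> sigma_finite setT mu.
Proof.
move=> [B cB [oB Bn]] cl0 subc [_ muT muK muO _].
have m0 : measurable ([set (0 : X)] : set (borel X)).
  rewrite -[X in measurable X]setCK; apply: measurableC; apply: borel_open.
  exact: closed_openC.
have mu0 := muK _ (@compact_set1 _ (0 : X)).
rewrite muO// in mu0.
have [_ [U [oU U0] <-] Uoo] := ereal_inf_lt mu0.
pose D := B `&` [set V : set X | (mu V < +oo)%E].
have cD : countable D by apply: sub_countable cB; apply: subset_card_le; exact: subIsetl.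
have TD : [set: X] = \bigcup_(V in D) V.
  apply/esym; rewrite -subTset => z _.
  have oUz : open [set x : X | U (x - z)].
    have -> : [set x : X | U (x - z)] = (fun x => x - z) @^-1` U by [].
    apply: open_comp => // x _.
    have /= := @continuous_comp _ _ _ (fun x : X => (x, z)) (fun p => p.1 - p.2) x.
    apply; last exact: subc.
    by apply: cvg_pair => //=; exact: cvg_cst.
  have [V [BV Vz] VU] : filter_from [set V | B V /\ V z] id [set x : X | U (x - z)].
    apply: Bn; apply: open_nbhs_nbhs; split => //=.
    by rewrite subrr; exact: U0.
  exists V => //; split => //.
  have zU : [set z + y | y in U] = [set x : X | U (x - z)].
    apply/seteqP; split=> [_ [y Uy <-] /=|x Uxz]; first by rewrite addrC addKr.
    by exists (x - z) => //; rewrite addrC subrK.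
  apply: le_lt_trans Uoo; rewrite -(muT z _ (borel_open oU)) zU.
  apply: le_measure; rewrite ?inE//.
    by apply: borel_open; exact: oB.
  exact: borel_open.
have [F DF FV] := countable_bigcup_sequence id cD.
exists F; first by rewrite -DF -TD.
move=> n; have [->|[V DV ->]] := FV n; first by rewrite measure0.
by split; [apply: borel_open; exact: (oB _ DV.1)|exact: DV.2].
Qed.

Definition aut_sym (G : topologicalZmodType) (alpha : aut G) : aut G.
Proof.
refine (@Aut G (aut_inv alpha) alpha _ (@autVK _ alpha) (@autK _ alpha)
  (@autV_continuous _ alpha) (@aut_continuous _ alpha)).
by move=> x y; apply: (can_inj (@autK _ alpha)); rewrite autD !autVK.
Defined.

Section DualHaar.
Variables (R : realType) (G : topologicalZmodType).
Hypothesis G_hausdorff : hausdorff_space G.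
Hypothesis G_locally_compact : locally_compact [set: G].
Hypothesis G_second_countable : @second_countable G.
Variable mGhat : {measure set (borel (dual R G)) -> \bar R}.
Hypothesis mGhat_haar : is_haar mGhat.

Lemma adjointK (alpha : aut G) : cancel (@adjoint G R alpha) (adjoint (aut_sym alpha)).
Proof. by move=> xi; apply: dual_ext => x /=; rewrite autVK. Qed.

Lemma adjointVK (alpha : aut G) : cancel (adjoint (aut_sym alpha)) (@adjoint G R alpha).
Proof. by move=> xi; apply: dual_ext => x /=; rewrite autK. Qed.

Lemma adjoint_image (alpha : aut G) (E : set (dual R G)) :
  [set adjoint alpha xi | xi in E] = adjoint (aut_sym alpha) @^-1` E.
Proof.
apply/seteqP; split=> [_ [xi Exi <-] /=|xi Exi]; first by rewrite adjointK.
by exists (adjoint (aut_sym alpha) xi) => //; rewrite adjointVK.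
Qed.

Lemma dual_closed0 : closed [set (0 : dual R G)].
Proof.
have -> : [set (0 : dual R G)] =
    \bigcap_(x in [set: G]) ((fun xi : dual R G => xi x : R[i]^o) @^-1` [set 1]).
  apply/seteqP; split=> [_ -> x _ //|xi h].
  by apply: dual_ext => x; exact: (h x I).
apply: closed_bigI => x _.
move/continuous_closedP : (@dual_eval_continuous R G x); apply.
exact/accessible_closed_set1/hausdorff_accessible/norm_hausdorff.
Qed.

Lemma measurable_adjoint (alpha : aut G) : measurable_fun [set: borel (dual R G)]
  (adjoint alpha : borel (dual R G) -> borel (dual R G)).
Proof. by apply: borel_continuous; exact: adjoint_continuous. Qed.

Lemma dual_haar_sigma_finite : sigma_finite setT mGhat.
Proof.
apply: haar_sigma_finite => //.
- exact: dual_second_countable.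
- exact: dual_closed0.
- exact: dual_sub_continuous.
Qed.

(** The image of Haar measure under an automorphism is again translation-invariant
    and sigma-finite. *)
Lemma adjoint_scaling (alpha : aut G) : exists2 c : R, 0 < c &
  forall E : set (borel (dual R G)), measurable E ->
    mGhat (adjoint alpha @^-1` (E : set (dual R G))) = (c%:E * mGhat E)%E.
Proof.
have [mT muT _ _ _] := mGhat_haar.
have [nu nuE] := pushforward_measure_exists mGhat (measurable_adjoint alpha).
have [c c0 cE] : exists2 c : R, 0 < c &
    forall E, measurable E -> nu E = (c%:E * mGhat E)%E.
  apply: translation_invariant_unique => //.
  - apply: borel_continuous2; first exact: dual_second_countable.
    exact: dual_sub_continuous.
  - exact: dual_haar_sigma_finite.
  - have [F FT mF] := dual_haar_sigma_finite.
    exists (fun n => adjoint (aut_sym alpha) @^-1` F n).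
      by rewrite -preimage_bigcup -FT preimage_setT.
    move=> n; split.
      rewrite -[X in measurable X]setTI; apply: measurable_adjoint => //.
      exact: (mF n).1.
    rewrite nuE /pushforward -comp_preimage (_ : _ \o _ = id) ?preimage_id.
      exact: (mF n).2.
    by apply/funext => xi /=; exact: adjointK.
  - move=> xi E mE; rewrite nuE /pushforward.
    have mE' : measurable (adjoint alpha @^-1` (E : set (dual R G)) : set (borel (dual R G))).
      by rewrite -[X in measurable X]setTI; exact: measurable_adjoint.
    rewrite -[RHS](muT (adjoint (aut_sym alpha) xi) _ mE').
    congr (mGhat _); apply/seteqP; split=> eta /=.
      move=> [zeta Ezeta h]; exists (adjoint (aut_sym alpha) zeta).
        by rewrite /= adjointVK.
      by rewrite -[RHS](adjointK alpha) -h; apply: dual_ext.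
    move=> [zeta Ezeta <-]; exists (adjoint alpha zeta) => //.
    by apply: dual_ext => x /=; rewrite autK.
  - by rewrite nuE /pushforward preimage_setT.
by exists c => // E mE; rewrite -cE// nuE.
Qed.

End DualHaar.

(** * Fourier transforms of translates and dilates *)

Section ComplexParts.
Variable R : realType.

Lemma Re_continuous : continuous (@complex.Re R : R[i]^o -> R).
Proof.
move=> z; have FF : Filter (nbhs (z : R[i]^o)) by exact: nbhs_filter.
apply/cvgrPdist_lt => e e0.
have ze : nbhs (z : R[i]^o) (ball (z : R[i]^o) e%:C).
  by apply: nbhsx_ballx; rewrite ltcR.
apply: filterS ze => w; rewrite /ball /= => zw.
rewrite -ltcR; apply: le_lt_trans zw.
apply: le_trans (normc_ge_Re _).
by case: (z) (w) => [a b] [c d].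
Unshelve. all: by end_near. Qed.

Lemma Im_continuous : continuous (@complex.Im R : R[i]^o -> R).
Proof.
move=> z; have FF : Filter (nbhs (z : R[i]^o)) by exact: nbhs_filter.
apply/cvgrPdist_lt => e e0.
have ze : nbhs (z : R[i]^o) (ball (z : R[i]^o) e%:C).
  by apply: nbhsx_ballx; rewrite ltcR.
apply: filterS ze => w; rewrite /ball /= => zw.
rewrite -ltcR; apply: le_lt_trans zw.
apply: (@le_trans _ _ `|'i * (z - w)|).
  apply: le_trans (normc_ge_Re _); rewrite -normrN.
  by case: (z) (w) => [a b] [c d] /=; simpc; rewrite lexx.
by rewrite normrM normc_def /= expr0n expr1n add0r sqrtr1 mul1r.
Qed.

Lemma cmeasurable_continuous (X : PreTopologicalZmodule.type) (f : X -> R[i]^o) :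
  continuous f -> cmeasurable [set: borel X] (f : borel X -> R[i]).
Proof.
move=> fc; split; apply: borel_continuousR => x.
  exact: (continuous_comp (fc x) (@Re_continuous (f x))).
exact: (continuous_comp (fc x) (@Im_continuous (f x))).
Qed.

End ComplexParts.

Section ScaledMeasure.
Context d (T : measurableType d) (R : realType).
Variables (mu : {measure set T -> \bar R}) (phi : T -> T) (k : R).
Hypothesis k0 : 0 <= k.
Hypothesis mphi : measurable_fun setT phi.
Hypothesis phi_scale : forall E, measurable E -> mu (phi @^-1` E) = (k%:E * mu E)%E.

(** The image of [mu] under [phi] is [k * mu], so this is the change of variables
    [y = phi x]. *)
Lemma ge0_integral_scaled (f : T -> \bar R) : measurable_fun setT f ->
  (forall x, 0 <= f x)%E ->
  (\int[mu]_x f (phi x) = k%:E * \int[mu]_x f x)%E.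
Proof.
move=> mf f0.
have -> : (\int[mu]_x f (phi x) = \int[pushforward mu phi]_x f x)%E.
  by rewrite ge0_integral_pushforward.
rewrite -[k in RHS]/((NngNum k0)%:num) -ge0_integral_mscale//.
apply: (eq_measure_integral (mscale (NngNum k0) mu)) => E mE _.
exact: phi_scale.
Qed.

Lemma integral_scaled (f : T -> \bar R) : mu.-integrable setT f ->
  mu.-integrable setT (f \o phi) /\
  (\int[mu]_x f (phi x) = k%:E * \int[mu]_x f x)%E.
Proof.
move=> /[dup] fi /integrableP[mf foo].
have fphi : mu.-integrable setT (f \o phi).
  apply/integrableP; split; first exact: measurableT_comp.
  rewrite (ge0_integral_scaled (f := fun x => `|f x|%E))//.
    by rewrite lte_mul_pinfty// lee_fin.
  exact: measurableT_comp.
split=> //.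
have e1 := ge0_integral_scaled (measurable_funepos mf) (fun x => funepos_ge0 f x).
have e2 := ge0_integral_scaled (measurable_funeneg mf) (fun x => funeneg_ge0 f x).
rewrite integralE [in RHS]integralE muleBr//; last exact: integrable_add_def.
rewrite -e1 -e2; congr (_ - _)%E; apply: eq_integral => x _; first by rewrite funepos_comp.
by rewrite funeneg_comp.
Qed.

Lemma L2_sqnorm_scaled (f : T -> R[i]) : cmeasurable setT f ->
  L2_sqnorm mu setT (fun x => f (phi x)) = (k%:E * L2_sqnorm mu setT f)%E.
Proof.
move=> mf; rewrite /L2_sqnorm.
apply: (ge0_integral_scaled (f := fun x => (Normc.normc (f x) ^+ 2)%:E)).
  exact: measurable_normc2.
by move=> x; rewrite lee_fin sqr_ge0.
Qed.

Lemma cmeasurable_scaled (f : T -> R[i]) : cmeasurable setT f ->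
  cmeasurable setT (fun x => f (phi x)).
Proof.
by move=> [f1 f2]; split; [exact: (measurableT_comp f1)|exact: (measurableT_comp f2)].
Qed.

Lemma in_L2_scaled (f : T -> R[i]) : in_L2 mu setT f ->
  in_L2 mu setT (fun x => f (phi x)).
Proof.
move=> [mf foo]; split; first exact: cmeasurable_scaled.
by rewrite L2_sqnorm_scaled// lte_mul_pinfty// lee_fin.
Qed.

Lemma in_L1_scaled (f : T -> R[i]) : in_L1 mu setT f ->
  in_L1 mu setT (fun x => f (phi x)) /\
  cintegral mu setT (fun x => f (phi x)) = k%:C * cintegral mu setT f.
Proof.
move=> [f1 f2]; have [i1 e1] := integral_scaled f1; have [i2 e2] := integral_scaled f2.
split=> //; rewrite /cintegral /Rintegral e1 e2 !fineM//; try exact: integrable_fin_num.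
by simpc.
Qed.
End ScaledMeasure.

Section ComplexIntegral.
Context d (T : measurableType d) (R : realType).
Variable mu : {measure set T -> \bar R}.
Implicit Types f g h : T -> R[i].

Lemma in_L1_measurable f : in_L1 mu setT f -> cmeasurable setT f.
Proof.
by move=> [/measurable_int/measurable_EFinP f1 /measurable_int/measurable_EFinP f2].
Qed.

Lemma in_L1D f g : in_L1 mu setT f -> in_L1 mu setT g ->
  in_L1 mu setT (fun x => f x + g x) /\
  cintegral mu setT (fun x => f x + g x) = cintegral mu setT f + cintegral mu setT g.
Proof.
move=> [f1 f2] [g1 g2].
have e1 x : complex.Re (f x + g x) = complex.Re (f x) + complex.Re (g x).
  by case: (f x) (g x) => ? ? [].
have e2 x : complex.Im (f x + g x) = complex.Im (f x) + complex.Im (g x).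
  by case: (f x) (g x) => ? ? [].
split.
  split.
    by under eq_fun do rewrite e1 EFinD; exact: integrableD.
  by under eq_fun do rewrite e2 EFinD; exact: integrableD.
by rewrite /cintegral (funext e1) (funext e2) !RintegralD//; simpc.
Qed.

Lemma in_L1Z (k : R[i]) f : in_L1 mu setT f ->
  in_L1 mu setT (fun x => k * f x) /\
  cintegral mu setT (fun x => k * f x) = k * cintegral mu setT f.
Proof.
move=> [f1 f2]; case: k => a b.
have e1 x : complex.Re ((a +i* b) * f x) =
    a * complex.Re (f x) - b * complex.Im (f x) by case: (f x).
have e2 x : complex.Im ((a +i* b) * f x) =
    a * complex.Im (f x) + b * complex.Re (f x) by case: (f x).
have Z (c : R) (u : T -> R) : mu.-integrable setT (EFin \o u) ->
    mu.-integrable setT (EFin \o (fun x => c * u x)).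
  by move=> ui; rewrite /comp; under eq_fun do rewrite EFinM; exact: integrableZl.
split.
  split.
    rewrite (_ : (fun x => _) =
      ((EFin \o (fun x => a * complex.Re (f x))%R) \-
       (EFin \o (fun x => b * complex.Im (f x))%R))%E).
      by apply: integrableB => //; exact: Z.
    by apply/funext => x; rewrite e1.
  rewrite (_ : (fun x => _) =
    ((EFin \o (fun x => a * complex.Im (f x))%R) \+
     (EFin \o (fun x => b * complex.Re (f x))%R))%E).
    by apply: integrableD => //; exact: Z.
  by apply/funext => x; rewrite e2.
rewrite /cintegral (funext e1) (funext e2) RintegralB ?RintegralD//; try exact: Z.
by rewrite !RintegralZl//; simpc.
Qed.

Lemma in_L1_mul_bounded f h : in_L1 mu setT f -> cmeasurable setT h ->
  (forall x, `|h x| = 1) -> in_L1 mu setT (fun x => f x * h x).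
Proof.
move=> fL1 mh h1; have mf := in_L1_measurable fL1.
have [m1 m2] := cmeasurableM mf mh; move: fL1 => [f1 f2].
have fi : mu.-integrable setT
    (fun x => (`|complex.Re (f x)| + `|complex.Im (f x)|)%:E).
  under eq_fun do rewrite EFinD.
  by apply: integrableD => //; exact: integrable_norm.
have bnd (a b c e : R) : c ^+ 2 + e ^+ 2 = 1 ->
    `|a * c - b * e| <= `|a| + `|b| /\ `|a * e + b * c| <= `|a| + `|b|.
  move=> ce; have c1 : `|c| <= 1 by rewrite ler_norml; nra.
  have e1 : `|e| <= 1 by rewrite ler_norml; nra.
  split; rewrite (le_trans (ler_normD _ _))// ?normrN !normrM;
    by rewrite lerD// ler_piMr.
have hh x : complex.Re (h x) ^+ 2 + complex.Im (h x) ^+ 2 = 1.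
  by rewrite -normc2E normc2_unit.
split.
  apply: (le_integrable measurableT _ _ fi); first exact/measurable_EFinP.
  move=> x _; rewrite lee_fin [leRHS]ger0_norm ?addr_ge0//.
  have := hh x; case: (f x) (h x) => [a b] [c e] /= ce.
  by have [] := bnd a b c e ce.
apply: (le_integrable measurableT _ _ fi); first exact/measurable_EFinP.
move=> x _; rewrite lee_fin [leRHS]ger0_norm ?addr_ge0//.
have := hh x; case: (f x) (h x) => [a b] [c e] /= ce.
by have [] := bnd a b c e ce.
Qed.

End ComplexIntegral.

Section Fourier.
Variables (R : realType) (G : topologicalZmodType).
Variable mG : {measure set (borel G) -> \bar R}.
Variable mGhat : {measure set (borel (dual R G)) -> \bar R}.
Hypothesis mG_mGhat : fourier_unitary mG mGhat.
Implicit Types (f : G -> R[i]) (g : dual R G -> R[i]) (xi : dual R G).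

Lemma char_conj xi x : (xi x)^*%C = (- xi) x.
Proof.
have := sqr_normc (xi x); rewrite char_norm expr1n => h.
by apply: (mulfI (char_neq0 xi x)); rewrite -h /= mulfV// char_neq0.
Qed.

Lemma char_opp xi x : xi (- x) = (- xi) x.
Proof.
apply: (mulfI (char_neq0 xi x)); rewrite -charD subrr /= mulfV ?char_neq0//.
by apply: (mulfI (char_neq0 xi 0)); rewrite -charD addr0 mulr1.
Qed.

Lemma fourierE f xi : fourier mG f xi =
  cintegral mG [set: borel G] (fun x => f x * (- xi) x).
Proof. by congr cintegral; apply/funext => x; rewrite char_conj. Qed.

Lemma cmeasurable_char xi : cmeasurable [set: borel G] xi.
Proof. exact/cmeasurable_continuous/char_continuous. Qed.

Lemma in_L1_char f xi : in_L1 mG [set: borel G] f ->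
  in_L1 mG [set: borel G] (fun x => f x * xi x).
Proof.
move=> f1; apply: in_L1_mul_bounded => //; first exact: cmeasurable_char.
by move=> x; exact: char_norm.
Qed.

Lemma fourierD f f' : in_L1 mG [set: borel G] f -> in_L1 mG [set: borel G] f' ->
  fourier mG (fun x => f x + f' x) = (fun xi => fourier mG f xi + fourier mG f' xi).
Proof.
move=> f1 f1'; apply/funext => xi; rewrite !fourierE.
rewrite -(in_L1D (in_L1_char (- xi) f1) (in_L1_char (- xi) f1')).2.
by congr cintegral; apply/funext => x; rewrite mulrDl.
Qed.

Lemma fourierZ (k : R[i]) f : in_L1 mG [set: borel G] f ->
  fourier mG (fun x => k * f x) = (fun xi => k * fourier mG f xi).
Proof.
move=> f1; apply/funext => xi; rewrite !fourierE.
rewrite -(in_L1Z k (in_L1_char (- xi) f1)).2.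
by congr cintegral; apply/funext => x; rewrite mulrA.
Qed.

Lemma L2_fourierD f f' g g' : L2_fourier mG mGhat f g -> L2_fourier mG mGhat f' g' ->
  L2_fourier mG mGhat (fun x => f x + f' x) (fun xi => g xi + g' xi).
Proof.
move=> [f2 g2 [u [u12 uf ug]]] [f2' g2' [u' [u12' uf' ug']]].
split; [exact: in_L2D|exact: in_L2D|].
exists (fun n x => u n x + u' n x); split.
- by move=> n; split;
    [exact: (in_L1D (u12 n).1 (u12' n).1).1|exact: in_L2D (u12 n).2 (u12' n).2].
- have := cvge0M 2 (cvge0D uf uf').
  apply: cvge0_le => n; first exact: L2_sqnorm_ge0.
  rewrite (L2_sqnorm_eq mG (g := fun x => (u n x - f x) + (u' n x - f' x))); last first.
    by move=> x _ /=; rewrite opprD addrACA.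
  by apply: L2_sqnormD2 => //; apply: cmeasurableB;
    [exact: (u12 n).2.1|exact: f2.1|exact: (u12' n).2.1|exact: f2'.1].
- have := cvge0M 2 (cvge0D ug ug').
  apply: cvge0_le => n; first exact: L2_sqnorm_ge0.
  rewrite (fourierD (u12 n).1 (u12' n).1).
  rewrite (L2_sqnorm_eq mGhat
    (g := fun x => (fourier mG (u n) x - g x) + (fourier mG (u' n) x - g' x))); last first.
    by move=> x _ /=; rewrite opprD addrACA.
  have [[m1 _] _] := mG_mGhat.1 _ (u12 n).1 (u12 n).2.
  have [[m2 _] _] := mG_mGhat.1 _ (u12' n).1 (u12' n).2.
  by apply: L2_sqnormD2 => //; apply: cmeasurableB => //; [exact: g2.1|exact: g2'.1].
Qed.

Lemma L2_fourierZ (k : R[i]) f g : L2_fourier mG mGhat f g ->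
  L2_fourier mG mGhat (fun x => k * f x) (fun xi => k * g xi).
Proof.
move=> [f2 g2 [u [u12 uf ug]]]; split; [exact: in_L2Z|exact: in_L2Z|].
exists (fun n x => k * u n x); split.
- by move=> n; split; [exact: (in_L1Z k (u12 n).1).1|exact: in_L2Z (u12 n).2].
- have := cvge0M (normc2 k) uf.
  apply: cvge0_le => n; first exact: L2_sqnorm_ge0.
  rewrite (L2_sqnorm_eq mG (g := fun x => k * (u n x - f x))); last first.
    by move=> x _ /=; rewrite mulrBr.
  by rewrite L2_sqnormZ//; apply: cmeasurableB; [exact: (u12 n).2.1|exact: f2.1].
- have := cvge0M (normc2 k) ug.
  apply: cvge0_le => n; first exact: L2_sqnorm_ge0.
  rewrite (fourierZ k (u12 n).1).
  rewrite (L2_sqnorm_eq mGhat (g := fun x => k * (fourier mG (u n) x - g x))); last first.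
    by move=> x _ /=; rewrite mulrBr.
  have [[m1 _] _] := mG_mGhat.1 _ (u12 n).1 (u12 n).2.
  by rewrite L2_sqnormZ//; apply: cmeasurableB => //; exact: g2.1.
Qed.

Lemma L2_fourier_isometry f g : L2_fourier mG mGhat f g ->
  L2_sqnorm mG [set: borel G] f = L2_sqnorm mGhat [set: borel (dual R G)] g.
Proof.
move=> [f2 g2 [u [u12 uf ug]]].
have ft n := mG_mGhat.1 _ (u12 n).1 (u12 n).2.
apply: (L2_sqnorm_lim (fun n => (u12 n).2) f2 (fun n => (ft n).1) g2 uf ug) => n.
exact/esym/(ft n).2.
Qed.

Lemma L2_fourier0 : L2_fourier mG mGhat (fun=> 0) (fun=> 0).
Proof.
have [f fg] := mG_mGhat.2 _ (in_L20 mGhat [set: borel (dual R G)]).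
have := L2_fourierZ 0 fg.
by under eq_fun do rewrite mul0r; under [X in L2_fourier _ _ _ X]eq_fun do rewrite mul0r.
Qed.

Lemma L2_fourierB f f' g g' : L2_fourier mG mGhat f g -> L2_fourier mG mGhat f' g' ->
  L2_fourier mG mGhat (fun x => f x - f' x) (fun xi => g xi - g' xi).
Proof.
move=> fg /(L2_fourierZ (-1)) fg'; have := L2_fourierD fg fg'.
by under eq_fun do rewrite mulN1r; under [X in L2_fourier _ _ _ X]eq_fun do rewrite mulN1r.
Qed.

Lemma L2_fourier_sum (I : eqType) (s : seq I) (c : I -> R[i]) (f : I -> G -> R[i])
    (g : I -> dual R G -> R[i]) :
  (forall i, i \in s -> L2_fourier mG mGhat (f i) (g i)) ->
  L2_fourier mG mGhat (fun x => \sum_(i <- s) c i * f i x)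
    (fun xi => \sum_(i <- s) c i * g i xi).
Proof.
elim: s => [|i s ih] fg.
  under eq_fun do rewrite big_nil; under [X in L2_fourier _ _ _ X]eq_fun do rewrite big_nil.
  exact: L2_fourier0.
under eq_fun do rewrite big_cons; under [X in L2_fourier _ _ _ X]eq_fun do rewrite big_cons.
apply: L2_fourierD; first by apply: L2_fourierZ; apply: fg; rewrite mem_head.
by apply: ih => j js; apply: fg; rewrite in_cons js orbT.
Qed.

End Fourier.

Lemma autN (G : topologicalZmodType) (alpha : aut G) x : alpha (- x) = - alpha x.
Proof.
have a0 : alpha 0 = 0 by apply: (addrI (alpha 0)); rewrite -autD !addr0.
by apply: (addrI (alpha x)); rewrite -autD !subrr.
Qed.

Section WaveletFourier.
Variables (R : realType) (G : topologicalZmodType).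
Hypothesis G_hausdorff : hausdorff_space G.
Hypothesis G_locally_compact : locally_compact [set: G].
Hypothesis G_second_countable : @second_countable G.
Variable mG : {measure set (borel G) -> \bar R}.
Variable mGhat : {measure set (borel (dual R G)) -> \bar R}.
Hypothesis mG_haar : is_haar mG.
Hypothesis mGhat_haar : is_haar mGhat.
Hypothesis mG_mGhat : fourier_unitary mG mGhat.
Variable Delta : aut G -> R.
Hypothesis Delta_modular : is_modular mG Delta.

Section Affine.
Variables (lambda : G) (alpha : aut G).
Let D := Delta alpha.
Let D0 : 0 < D. Proof. exact: (Delta_modular alpha).1. Qed.
Let tau (x : G) : G := alpha x - lambda.

Let measurable_tau : measurable_fun [set: borel G] (tau : borel G -> borel G).
Proof.
apply: borel_continuous => x.
have /= := @continuous_comp _ _ _ (fun x : G => (alpha x, lambda))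
  (fun p : G * G => p.1 - p.2) x.
apply; last exact: sub_continuous.
by apply: cvg_pair => //=; [exact: aut_continuous|exact: cvg_cst].
Qed.

(** [alpha] maps the preimage of [E] onto the translate [lambda + E]. *)
Lemma affine_scale (E : set (borel G)) : measurable E ->
  mG (tau @^-1` E) = ((D^-1)%:E * mG E)%E.
Proof.
move=> mE; have mE' : measurable (tau @^-1` E : set (borel G)).
  by rewrite -[X in measurable X]setTI; exact: measurable_tau.
have [_ muT _ _ _] := mG_haar.
rewrite -(muT lambda _ mE).
have -> : [set lambda + y | y in (E : set G)] =
    [set alpha x | x in (tau @^-1` E : set G)].
  apply/seteqP; split=> [_ [y Ey <-]|_ [x Ex <-]].
    exists (aut_inv alpha (lambda + y)); last by rewrite autVK.
    by rewrite /tau /= autVK addrC addKr.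
  by exists (tau x) => //; rewrite /tau addrC subrK.
rewrite (Delta_modular alpha).2// muleA -EFinM mulVf ?mul1e//.
exact: lt0r_neq0.
Qed.

Let W (u : G -> R[i]) := wavelet Delta u (lambda, alpha).

(** What the operator [W] becomes under the Fourier transform: the modulation by
    the character of the dual group given by [- alpha^-1 lambda], after a
    dilation by the inverse adjoint. *)
Definition modulated_dilation (g : dual R G -> R[i]) (xi : dual R G) : R[i] :=
  (Num.sqrt D)^-1%:C * xi (- aut_inv alpha lambda) * g (adjoint (aut_sym alpha) xi).

Let V0 : 0 <= D^-1. Proof. by rewrite invr_ge0 ltW. Qed.

Let normc2_sqrtD : normc2 (Num.sqrt D)%:C = D.
Proof. by rewrite normc2_real sqr_sqrtr// ltW. Qed.

Lemma wavelet_L1 u : in_L1 mG [set: borel G] u -> in_L1 mG [set: borel G] (W u).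
Proof.
move=> u1; apply: (in_L1Z _ _).1.
by have [] := in_L1_scaled V0 measurable_tau affine_scale u1.
Qed.

Lemma wavelet_L2 u : in_L2 mG [set: borel G] u -> in_L2 mG [set: borel G] (W u).
Proof.
move=> u2; apply: in_L2Z => //.
exact: (in_L2_scaled V0 measurable_tau affine_scale u2).
Qed.

Lemma wavelet_sqnorm u : cmeasurable [set: borel G] u ->
  L2_sqnorm mG [set: borel G] (W u) = L2_sqnorm mG [set: borel G] u.
Proof.
move=> mu; rewrite /W /wavelet L2_sqnormZ//=; last first.
  exact: (cmeasurable_scaled measurable_tau).
rewrite (L2_sqnorm_scaled V0 measurable_tau affine_scale)//.
by rewrite normc2_sqrtD muleA -EFinM mulfV ?mul1e// lt0r_neq0.
Qed.

(** The change of variables [y = alpha x - lambda], in which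
    [- x = - alpha^-1 lambda + alpha^-1 (- y)]. *)
Lemma fourier_wavelet u : in_L1 mG [set: borel G] u ->
  fourier mG (W u) = modulated_dilation (fourier mG u).
Proof.
move=> u1; apply/funext => xi; rewrite /modulated_dilation !fourierE.
set eta := - adjoint (aut_sym alpha) xi.
pose k := (Num.sqrt D)%:C * xi (- aut_inv alpha lambda).
pose H (y : G) := k * (u y * eta y).
have etaE y : eta y = xi (aut_inv alpha (- y)) by rewrite /eta -char_opp.
have -> : (fun x => W u x * (- xi) x) = (fun x => H (tau x)).
  apply/funext => x; rewrite /W /wavelet /H /k etaE -char_opp -/(tau x).
  have -> : - x = - aut_inv alpha lambda + aut_inv alpha (- tau x).
    apply: (can_inj (@autK _ alpha)).
    by rewrite autD !autN !autVK /tau opprB addKr.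
  by rewrite charD; ring.
have H1 : in_L1 mG [set: borel G] H.
  by apply: (in_L1Z _ _).1; exact: in_L1_char.
rewrite (in_L1_scaled V0 measurable_tau affine_scale H1).2.
rewrite (in_L1Z _ (in_L1_char eta u1)).2 /k !mulrA; congr (_ * _ * _).
rewrite -rmorphM /=; congr (_%:C).
by rewrite -[X in X^-1 * _](@sqr_sqrtr _ D) ?ltW// expr2 invfM -mulrA mulVf ?mulr1//
  sqrtr_eq0 -ltNge.
Qed.

(** The dilation is bounded because the adjoint automorphism multiplies Haar
    measure by a constant.  This is what lets the formula for integrable functions
    pass to the limit in L^2, and what makes it insensitive to the values of [g]
    on a null set. *)
Lemma modulated_dilation_L2 : exists2 c : R, 0 <= c &
  forall g, in_L2 mGhat [set: borel (dual R G)] g ->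
    in_L2 mGhat [set: borel (dual R G)] (modulated_dilation g) /\
    L2_sqnorm mGhat [set: borel (dual R G)] (modulated_dilation g) =
    (c%:E * L2_sqnorm mGhat [set: borel (dual R G)] g)%E.
Proof.
have [c c0 cE] := adjoint_scaling G_hausdorff G_locally_compact
  G_second_countable mGhat_haar (aut_sym alpha).
have madj : measurable_fun [set: borel (dual R G)]
    (adjoint (aut_sym alpha) : borel (dual R G) -> borel (dual R G)).
  exact: measurable_adjoint.
have chi : cmeasurable [set: borel (dual R G)]
    (fun xi : dual R G => (Num.sqrt D)^-1%:C * xi (- aut_inv alpha lambda)).
  apply: cmeasurableM; first exact: cmeasurable_cst.
  by apply: cmeasurable_continuous; exact: dual_eval_continuous.
exists (D^-1 * c); first by rewrite mulr_ge0// ltW.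
move=> g g2.
have mg := cmeasurable_scaled madj g2.1.
have normE : L2_sqnorm mGhat [set: borel (dual R G)] (modulated_dilation g) =
    ((D^-1 * c)%:E * L2_sqnorm mGhat [set: borel (dual R G)] g)%E.
  rewrite EFinM -muleA -(L2_sqnorm_scaled (ltW c0) madj cE g2.1).
  transitivity (L2_sqnorm mGhat [set: borel (dual R G)]
      (fun xi => (Num.sqrt D)^-1%:C * g (adjoint (aut_sym alpha) xi))).
    apply: eq_integral => xi _; rewrite -!/(normc2 _) /modulated_dilation !normc2M.
    by rewrite (normc2_unit (char_norm _ _)) mulr1.
  rewrite L2_sqnormZ//; congr (_%:E * _)%E.
  by rewrite normc2_real exprVn sqr_sqrtr// ltW.
split=> //; split; first exact: cmeasurableM.
rewrite normE lte_mul_pinfty//; last exact: g2.2.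
by rewrite lee_fin mulr_ge0// ltW.
Qed.

(** The wavelets of the approximations of [u] approximate the wavelet of [u], and
    their transforms approximate [modulated_dilation g]. *)
Lemma L2_fourier_wavelet u g : L2_fourier mG mGhat u g ->
  L2_fourier mG mGhat (W u) (modulated_dilation g).
Proof.
have [c c0 cV] := modulated_dilation_L2.
move=> [u2 g2 [v [v12 vu vg]]].
split; [exact: wavelet_L2|exact: (cV g g2).1|].
exists (fun n => W (v n)); split.
- by move=> n; split; [exact: wavelet_L1 (v12 n).1|exact: wavelet_L2 (v12 n).2].
- apply: cvge0_le vu => n; first exact: L2_sqnorm_ge0.
  rewrite -[leRHS]wavelet_sqnorm.
    rewrite (L2_sqnorm_eq mG (g := W (v n \- u)))// => x _ /=.
    by rewrite /W /wavelet /= mulrBr.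
  by apply: cmeasurableB; [exact: (v12 n).2.1|exact: u2.1].
- have := cvge0M c vg; apply: cvge0_le => n; first exact: L2_sqnorm_ge0.
  rewrite (fourier_wavelet (v12 n).1).
  have [ft2 _] := mG_mGhat.1 _ (v12 n).1 (v12 n).2.
  rewrite -(cV _ (in_L2B measurableT ft2 g2)).2.
  rewrite (L2_sqnorm_eq mGhat (g := modulated_dilation (fourier mG (v n) \- g)))//.
  by move=> x _ /=; rewrite /modulated_dilation /= mulrBr.
Qed.

End Affine.
End WaveletFourier.

(** * Tilings and spectral pairs *)

Lemma riesz_basis_fourier (R : realType) (G : topologicalZmodType)
    (mG : {measure set (borel G) -> \bar R})
    (mGhat : {measure set (borel (dual R G)) -> \bar R})
    (I : choiceType) (D : set I) (f : I -> borel G -> R[i]) (g : I -> borel (dual R G) -> R[i]) :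
  fourier_unitary mG mGhat ->
  (forall i, D i -> L2_fourier mG mGhat (f i) (g i)) ->
  riesz_basis mG [set: borel G] D f -> riesz_basis mGhat [set: borel (dual R G)] D g.
Proof.
move=> FU fg [_ fc [a [b [a0 b0 ab]]]].
have fgF (F : {fset I}) c : [set` F] `<=` D ->
    L2_fourier mG mGhat (lincomb f F c) (lincomb g F c).
  by move=> FD; apply: L2_fourier_sum => // i iF; apply: fg; exact: FD.
split.
- by move=> i /fg[].
- move=> k k2 eps eps0; have [h hk] := FU.2 k k2.
  have [h2 _ _] := hk; have [F [c [FD Fc]]] := fc h h2 eps eps0.
  exists F, c; split => //.
  by rewrite -(L2_fourier_isometry FU (L2_fourierB FU hk (fgF F c FD))).
- exists a, b; split => // F c FD.
  by rewrite -(L2_fourier_isometry FU (fgF F c FD)); exact: ab.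
Qed.

Section PointwiseTiling.
Variables (R : realType) (T : Type) (J : choiceType) (A : set J) (E : J -> set T).

Lemma esum_indic_disjoint (x : T) :
  (\esum_(j in A) (\1_(E j) x : R)%:E = 1)%E ->
  forall j k, A j -> A k -> E j x -> E k x -> j = k.
Proof.
move=> sum1 j k Aj Ak Ejx Ekx; apply: contrapT => /eqP jk.
have : (2%:E <= \esum_(j in A) (\1_(E j) x : R)%:E)%E.
  apply: esum_ge; exists [set j; k].
    by split; [exact: finite_set2|move=> _ [->|->]].
  rewrite fsbigU0//= => [|_ [-> kj]]; last by move: jk; rewrite kj eqxx.
  by rewrite !fsbig_set1 !indicE !mem_set//= -EFinD lexx.
by rewrite sum1 lee_fin; lra.
Qed.

Lemma esum_indic_partition (x : T) :
  (forall j k, A j -> A k -> E j x -> E k x -> j = k) ->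
  (exists2 j, A j & E j x) ->
  (\esum_(j in A) (\1_(E j) x : R)%:E = 1)%E.
Proof.
move=> disj [j Aj Ejx].
rewrite (esumID [set j])//.
rewrite [X in (_ + X)%E]esum1 ?adde0.
  rewrite (_ : A `&` [set j] = [set j]).
    by rewrite esum_set1 indicE ?mem_set ?lee_fin.
  by apply/seteqP; split=> [i []//|i ->].
move=> i [Ai /= ij]; rewrite indicE memNset// => Eix.
by apply: ij; exact: disj.
Qed.

End PointwiseTiling.

Theorem theorem2p6 (R : realType) (G : topologicalZmodType)
  (G_hausdorff : hausdorff_space G)
  (G_locally_compact : locally_compact [set: G])
  (G_second_countable : @second_countable G)
  (G_infinite : infinite_set [set: G])
  (G_nondiscrete : ~ is_discrete G)
  (G_lattice : exists L : subgroup G, is_lattice L)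
  (mG : {measure set (borel G) -> \bar R})
  (mGhat : {measure set (borel (dual R G)) -> \bar R})
  (mG_haar : is_haar mG)
  (mGhat_haar : is_haar mGhat)
  (mG_mGhat : fourier_unitary mG mGhat)
  (Delta : aut G -> R)
  (Delta_modular : is_modular mG Delta)
  (Delta_nontrivial : exists alpha, Delta alpha <> 1)
  (Omega : set (borel (dual R G)))
  (Omega_measurable : measurable Omega)
  (Omega_finite : (mGhat Omega < +oo)%E)
  (Omega_nonzero : mGhat Omega != 0%E)
  (Lambda : set G) (Lambda_countable : countable Lambda)
  (A : set (aut G)) (A_countable : countable A)
  (Omega_wavelet : riesz_wavelet_set mG mGhat Delta Omega Lambda A) :
  multiplicative_tiling mGhat Omega A <->
  (forall alpha, A alpha ->
     riesz_spectral_pair mGhat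
       [set adjoint alpha xi | xi in (Omega : set (dual R G))]
       (alpha @^-1` [set - lambda | lambda in Lambda])).
Proof.
have [psi [psi_hat psi_basis]] := Omega_wavelet.
pose E (alpha : aut G) : set (borel (dual R G)) :=
  [set adjoint alpha xi | xi in (Omega : set (dual R G))].
pose s alpha : R[i] := (Num.sqrt (Delta alpha))%:C.
pose e (p : G * aut G) (xi : dual R G) : R[i] :=
  (Num.sqrt (Delta p.2))^-1%:C * xi (- aut_inv p.2 p.1).
have EE alpha : E alpha = adjoint (aut_sym alpha) @^-1` Omega by exact: adjoint_image.
have mE alpha : measurable (E alpha).
  by rewrite EE -[X in measurable X]setTI; exact: measurable_adjoint.
have E_pos alpha : mGhat (E alpha) != 0%E /\ (mGhat (E alpha) < +oo)%E.
  have [c c0 cE] := adjoint_scaling G_hausdorff G_locally_compact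
    G_second_countable mGhat_haar (aut_sym alpha).
  rewrite EE cE//; split; last by rewrite lte_mul_pinfty// lee_fin ltW.
  by rewrite mule_eq0 negb_or Omega_nonzero andbT eqe gt_eqF.
have phi_basis : riesz_basis mGhat [set: borel (dual R G)] (Lambda `*` A)
    (fun p xi => e p xi * (\1_(E p.2) xi)%:C).
  apply: (riesz_basis_fourier mG_mGhat _ psi_basis) => -[lambda alpha] _.
  have := L2_fourier_wavelet G_hausdorff G_locally_compact G_second_countable
    mG_haar mGhat_haar mG_mGhat Delta_modular lambda alpha psi_hat.
  congr L2_fourier; apply/funext => xi; rewrite /modulated_dilation /e /=.
  by rewrite EE.
have r0 alpha : Num.sqrt (Delta alpha) != 0.
  by rewrite gt_eqF// sqrtr_gt0 (Delta_modular alpha).1.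
have s0 alpha : s alpha != 0 by rewrite /s fmorph_eq0.
have autK' (alpha : aut G) : cancel (fun lambda => - aut_inv alpha lambda)
                          (fun t => - alpha t).
  by move=> x; rewrite autN autVK opprK.
have autK'' (alpha : aut G) : cancel (fun t => - alpha t)
                          (fun lambda => - aut_inv alpha lambda).
  have autVN x : aut_inv alpha (- x) = - aut_inv alpha x := autN (aut_sym alpha) x.
  by move=> x; rewrite autVN autK opprK.
(* The spectrum alpha^-1 (- Lambda) is the image of Lambda under the bijection
   lambda |-> - alpha^-1 lambda of G. *)
have pair alpha : A alpha ->
    riesz_basis mGhat (E alpha) Lambda (fun lambda => e (lambda, alpha)) <->
    riesz_basis mGhat (E alpha) (alpha @^-1` [set - lambda | lambda in Lambda])
      (fun (t : G) (xi : dual R G) => xi t).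
  move=> Aa; split=> [/(riesz_basis_reindex (mE alpha) (autK'' alpha) (autK' alpha) (s0 alpha))|
    /(riesz_basis_reindex (mE alpha) (autK' alpha) (autK'' alpha) (invr_neq0 (s0 alpha)))].
    congr riesz_basis.
      apply/seteqP; split=> t /= => [Lt|[l Ll <-]]; last by rewrite opprK.
      by exists (- alpha t) => //; rewrite opprK.
    apply/funext => t; apply/funext => xi; rewrite /e /= autK'' mulrA.
    by rewrite -rmorphM /= mulfV ?mul1r.
  congr riesz_basis.
    apply/seteqP; split=> l /=; rewrite -/(aut_fun _) autN autVK.
      by move=> [l' Ll' /oppr_inj <-].
    by move=> Ll; exists l.
  apply/funext => l; apply/funext => xi; rewrite /e /= /s.
  by congr (_ * _); rewrite fmorphV.
split=> [tiling alpha Aa|pairs].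
  split; [exact: mE|exact: (E_pos alpha).1| |].
    apply: (sub_countable _ (card_le_trans (card_image_le (aut_inv alpha) _)
      (card_le_trans (card_image_le -%R _) Lambda_countable))).
    apply: subset_card_le => t [l Ll lt].
    by exists (alpha t); [exists l|exact: autK].
  apply/(pair alpha Aa).
  apply: (riesz_basis_piece mE phi_basis Aa).
  change (mGhat.-negligible (~` [set xi | forall a b, A a -> A b ->
    E a xi -> E b xi -> a = b])).
  apply: negligibleS tiling => xi nxi sum1; apply: nxi.
  exact: (@esum_indic_disjoint R (dual R G) (aut G) A E xi sum1).
have basis alpha : A alpha ->
    riesz_basis mGhat (E alpha) Lambda (fun lambda => e (lambda, alpha)).
  by move=> Aa; apply/(pair alpha Aa); have [] := pairs alpha Aa.
have disj : {ae mGhat, forall xi, forall alpha beta, A alpha -> A beta ->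
    E alpha xi -> E beta xi -> alpha = beta}.
  pose D := (A `*` A) `&` [set p | p.1 != p.2].
  have cD : countable D.
    apply: (sub_countable _ (countableX A_countable A_countable)).
    by apply: subset_card_le; exact: subIsetl.
  have N : mGhat.-negligible (\bigcup_(p in D) (E p.1 `&` E p.2)).
    apply: negligible_bigcup_countable => // -[a b] [/= [Aa Ab] ab].
    apply/negligibleP; first exact: measurableI.
    exact: (riesz_pieces_disjoint mE phi_basis Aa Ab ab (E_pos a).2 (E_pos b).2
      (basis a Aa) (basis b Ab)).
  change (mGhat.-negligible (~` [set xi | forall a b, A a -> A b ->
    E a xi -> E b xi -> a = b])).
  apply: negligibleS N => xi nxi; apply: contrapT => nD; apply: nxi => a b Aa Ab Ea Eb.
  by apply: contrapT => /eqP ab; apply: nD; exists (a, b).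
have cover : {ae mGhat, forall xi, exists2 alpha, A alpha & E alpha xi}.
  apply: (riesz_pieces_cover mE phi_basis A_countable).
  exact: (dual_haar_sigma_finite G_hausdorff).
apply: negligibleS (negligibleU disj cover) => xi nxi.
apply: contrapT => /not_orP[/contrapT disjxi /contrapT coverxi]; apply: nxi.
exact: (@esum_indic_partition R (dual R G) (aut G) A E xi disjxi coverxi).
Qed.
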